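(* Let $G$ be a nontrivial finitely generated group with a word metric $d_S$ corresponding to a finite generating set $S$. Let $H\le Aut(G)$ be a noncyclic subgroup with a finite generating set $T$. Then: (1) There is a number $\nu=\nu(H,T,S)\ge 0$ such that for the non-backtracking simple random walk $\phi_n$ on the Cayley graph of $H$ with respect to $T$ we have $$\lim_{n\to\infty}\frac{\log\|\phi_n\|_S}{n}=\nu$$ almost surely and in $L^1$. (2) If $G$ has polynomial growth and $H$ is non-amenable, then $\nu(H,T,S)>0$.
   Context: Write $|g|_S=d_S(1,g)$. For $\phi\in Aut(G)$, $\|\phi\|_S:=\max_{s\in S}|\phi(s)|_S$. The non-backtracking simple random walk $\phi_n$ on the Cayley graph of $H$ with respect to $T$ is the image in $H$ of the non-backtracking simple random walk on the free group $F(T)$ with basis $T$ (under the natural homomorphism $F(T)\to H$): that is, $\phi_n=t_1t_2\cdots t_n$, where $t_1t_2t_3\dots$ is a random semi-infinite freely reduced word over $T^{\pm1}$, $t_1$ being uniformly distributed on the $2\#T$ letters of $T^{\pm1}$ and each $t_{i+1}$ being, conditionally on $t_1,\dots,t_i$, uniformly distributed on the $2\#T-1$ letters different from $t_i^{-1}$ (as letters of the free group). *)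

(* Defs.v *)
From HB Require Import structures.
From mathcomp Require Import all_boot all_order all_algebra finmap.
From mathcomp Require Import all_classical all_reals all_analysis.
Export numFieldNormedType.Exports.

Set Implicit Arguments.
Unset Strict Implicit.
Unset Printing Implicit Defensive.

Import Order.TTheory GRing.Theory Num.Theory.

Local Open Scope classical_set_scope.
Local Open Scope group_scope.

Section Automorphisms.
Variable gT : groupType.

Record aut := Aut {
  aut_fun :> gT -> gT;
  aut_morph : {morph aut_fun : x y / x * y};
  aut_bij : bijective aut_fun }.

Lemma aut_ext (f g : aut) : f =1 g -> f = g.
Proof.
case: f g => [f fM fB] [g gM gB] /= /funext fg; case: _ / fg gM gB => gM gB.
by rewrite (Prop_irrelevance fM gM) (Prop_irrelevance fB gB).
Qed.

HB.instance Definition _ := gen_eqMixin aut.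
HB.instance Definition _ := gen_choiceMixin aut.

Definition aut_one : aut :=
  @Aut id (fun _ _ => erefl) (Bijective (frefl id) (frefl id)).

Lemma aut_mul_morph (f g : aut) : {morph f \o g : x y / x * y}.
Proof. by move=> x y /=; rewrite !aut_morph. Qed.

(* As for function composition, the right factor acts first. *)
Definition aut_mul (f g : aut) : aut :=
  Aut (aut_mul_morph f g) (bij_comp (aut_bij f) (aut_bij g)).

Lemma aut_inv_ex (f : aut) : exists g, cancel f g /\ cancel g f.
Proof. by case: (aut_bij f) => g fK gK; exists g. Qed.

Definition aut_inv_fun (f : aut) : gT -> gT := projT1 (cid (aut_inv_ex f)).

Lemma aut_invK (f : aut) : cancel f (aut_inv_fun f).
Proof. exact: (projT2 (cid (aut_inv_ex f))).1. Qed.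

Lemma aut_invKV (f : aut) : cancel (aut_inv_fun f) f.
Proof. exact: (projT2 (cid (aut_inv_ex f))).2. Qed.

Lemma aut_inv_morph (f : aut) : {morph aut_inv_fun f : x y / x * y}.
Proof.
by move=> x y; apply: (can_inj (aut_invK f)); rewrite aut_morph !aut_invKV.
Qed.

Definition aut_inv (f : aut) : aut :=
  Aut (aut_inv_morph f) (Bijective (aut_invKV f) (aut_invK f)).

Lemma aut_mulA : associative aut_mul.
Proof. by move=> f g h; apply: aut_ext => x. Qed.

Lemma aut_mul1 : left_id aut_one aut_mul.
Proof. by move=> f; apply: aut_ext => x. Qed.

Lemma aut_mulr1 : right_id aut_one aut_mul.
Proof. by move=> f; apply: aut_ext => x. Qed.

Lemma aut_mulV : left_inverse aut_one aut_inv aut_mul.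
Proof. by move=> f; apply: aut_ext => x /=; rewrite aut_invK. Qed.

Lemma aut_mulrV : right_inverse aut_one aut_inv aut_mul.
Proof. by move=> f; apply: aut_ext => x /=; rewrite aut_invKV. Qed.

HB.instance Definition _ := isGroup.Build aut
  aut_mulA aut_mul1 aut_mulr1 aut_mulV aut_mulrV.

End Automorphisms.

Section Groups.
Variable gT : groupType.

Definition subgroup (H : set gT) : Prop := group_closed (mem H).

Definition generated (A : set gT) : set gT := smallest subgroup A.

Definition cyclic_subgroup (H : set gT) : Prop :=
  exists h : gT, H = generated [set h].

(* Amenability of H as a discrete group: a finitely additive, left-invariant
   probability measure defined on all subsets of H. *)
Definition amenable (R : realType) (H : set gT) : Prop :=
  exists mu : set gT -> R,
    [/\ forall A, A `<=` H -> (0 <= mu A)%R,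
        mu H = 1%R,
        forall A B, A `<=` H -> B `<=` H -> A `&` B = set0 ->
          mu (A `|` B) = (mu A + mu B)%R
      & forall h A, H h -> A `<=` H ->
          mu [set h * x | x in A] = mu A].

Definition word_over (S : {fset gT}) (w : seq gT) : bool :=
  all (fun x => (x \in S) || (x^-1 \in S)) w.

Definition has_word (S : {fset gT}) (g : gT) (n : nat) : Prop :=
  exists w : seq gT, [/\ word_over S w, size w = n & \prod_(x <- w) x = g].

(* |g|_S, the least length of a word over S and its inverses that represents g;
   the value is 0 when g is not in the subgroup generated by S. *)
Definition word_length (S : {fset gT}) (g : gT) : nat :=
  xget 0%N [set n | has_word S g n /\
                    forall m, has_word S g m -> (n <= m)%N].

Definition word_ball (S : {fset gT}) (n : nat) : set gT :=
  [set g | (word_length S g <= n)%N].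

Definition generating_set (S : {fset gT}) : Prop :=
  generated [set` S] = [set: gT].

Definition aut_norm (S : {fset gT}) (phi : aut gT) : nat :=
  \max_(s <- S) word_length S (phi s).

End Groups.

(* The growth type does not depend on the finite generating set S. *)
Definition polynomial_growth (gT : groupType) : Prop :=
  exists2 S : {fset gT}, generating_set S &
    exists C d : nat, forall n : nat, (0 < n)%N ->
      (word_ball S n #<= `I_(C * n ^ d)%N)%card.

(* The letter (x, true) stands for x, and (x, false) for the formal inverse
   of x; they are distinct even when x is an involution of the group. *)
Definition letter (X : finType) : finType := (X * bool)%type.

Definition letter_inv (X : finType) (a : letter X) : letter X :=
  (a.1, ~~ a.2).

Definition letter_val (hT : groupType) (T : {fset hT}) (a : letter T) : hT :=
  if a.2 then val a.1 else (val a.1)^-1.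

Section RandomWalk.
Local Open Scope ring_scope.
Context {R : realType} {d : measure_display} {Omega : measurableType d}.
Variable P : probability Omega R.

(* t n is the (n+1)-st letter. The last clause says that, given that the first
   n+1 letters are u 0, ..., u n, the next one is uniformly distributed on the
   letters different from the inverse of u n; it is written multiplicatively,
   so that conditioning on an event of probability 0 imposes nothing more. *)
Definition nonbacktracking_word (X : finType) (t : nat -> Omega -> letter X)
    : Prop :=
  [/\ forall n a, measurable (t n @^-1` [set a]),
      forall a, P (t 0%N @^-1` [set a]) = ((2 * #|X|)%N%:R^-1)%:E
    & forall (n : nat) (u : nat -> letter X),
        P [set w | forall i, (i <= n.+1)%N -> t i w = u i] =
        (P [set w | forall i, (i <= n)%N -> t i w = u i] *
         (if u n.+1 == letter_inv (u n) then 0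
          else (2 * #|X| - 1)%N%:R^-1)%:E)%E].

Definition walk (hT : groupType) (T : {fset hT})
    (t : nat -> Omega -> letter T) (n : nat) (w : Omega) : hT :=
  (\prod_(i < n) letter_val (t i w))%g.

Definition cvg_as (X : nat -> Omega -> R) (l : R) : Prop :=
  {ae P, forall w, X ^~ w @ \oo --> l}.

Definition cvg_L1 (X : nat -> Omega -> R) (l : R) : Prop :=
  (forall n, X n \in Lfun P 1%E) /\
  ('N[P]_1[(fun w => (X n w - l)%R%:E)])%E @[n --> \oo] --> 0%E.

End RandomWalk.

Definition log_growth_rate {R : realType} {Omega : Type} (gT : groupType)
    (S : {fset gT}) (phi : nat -> Omega -> aut gT) (n : nat) (w : Omega) : R :=
  (ln (aut_norm S (phi n w))%:R / n%:R)%R.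

(* Main.v *)
(* The walk is a stationary ergodic process and log ||.|| is subadditive along
   it, so (1) is an instance of Kingman's theorem.  Letters change log ||.|| by
   a bounded amount on either side, hence the event that X_n <= c n + K for
   infinitely many n, for some K, is exactly shift invariant and has
   probability 0 or 1; a covering argument excludes 1 when c < nu.  Applied to
   minus the Birkhoff sums of X_m, the same lower bound yields the upper one.

   For (2), if nu = 0 then log ||.|| has mean o(n) under the non-backtracking
   walk, hence also under the simple random walk, which is a mixture of
   non-backtracking walks.  An automorphism is determined by its values on S, so
   polynomial growth makes {||.|| <= exp (eps n)} a set of subexponential size.
   The squared l2-norms of the n-step distributions s_n thus do not decay
   exponentially, and along a subsequence the loss ||s_n||^2 - ||s_(n+1)||^2,
   which is the mean squared distance from s_(n+1) to the translates of s_n, is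
   small relative to ||s_n||^2.  Then s_n^2 + s_(n+1)^2, normalized, is almost
   invariant, and an ultrafilter limit is an invariant mean. *)
Require Import Defs.
From HB Require Import structures.
From mathcomp Require Import all_boot all_order all_algebra finmap.
From mathcomp Require Import all_classical all_reals all_analysis.
From mathcomp Require Import measurable_realfun.
From mathcomp Require Import zify ring lra.

Set Implicit Arguments.
Unset Strict Implicit.
Unset Printing Implicit Defensive.

Import Order.TTheory GRing.Theory Num.Theory.

Local Open Scope classical_set_scope.
Local Open Scope ring_scope.

(** * Word lengths and norms of automorphisms *)

Section WordLength.
Local Open Scope group_scope.
Variable gT : groupType.
Implicit Types (S : {fset gT}) (x y g : gT).

Lemma subgroup1 (H : set gT) : subgroup H -> H 1.
Proof. by move=> [/set_mem]. Qed.

Lemma subgroupV (H : set gT) x : subgroup H -> H x -> H x^-1.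
Proof. by move=> /group_closedV HV /mem_set/HV/set_mem. Qed.

Lemma subgroupM (H : set gT) x y : subgroup H -> H x -> H y -> H (x * y).
Proof. by move=> /group_closedM HM /mem_set xH /mem_set/(HM _ _ xH)/set_mem. Qed.

Lemma generated_group (A : set gT) : subgroup (generated A).
Proof.
split; first by apply/mem_set => B [[/set_mem B1 _] _].
move=> x y /set_mem xA /set_mem yA; apply/mem_set => B AB.
by have /set_mem := AB.1.2 x y (mem_set (xA B AB)) (mem_set (yA B AB)).
Qed.

Lemma generated_sub (A B : set gT) :
  subgroup B -> A `<=` B -> generated A `<=` B.
Proof. exact: smallest_sub. Qed.

Lemma has_word1 S : has_word S 1 0.
Proof. by exists [::]; rewrite big_nil. Qed.

Lemma has_wordM S x y m n :
  has_word S x m -> has_word S y n -> has_word S (x * y) (m + n).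
Proof.
move=> [u [uS <- <-]] [v [vS <- <-]]; exists (u ++ v).
by rewrite /word_over all_cat size_cat big_cat; split => //; apply/andP.
Qed.

Lemma has_wordV S x n : has_word S x n -> has_word S x^-1 n.
Proof.
move=> [u [uS <- <-]]; elim: u uS => [|a u IH] /=.
  by rewrite big_nil invg1 => _; exact: has_word1.
move=> /andP[aS /IH uS]; rewrite big_cons invgM -addn1; apply: has_wordM => //.
by exists [:: a^-1]; rewrite /= big_seq1 invgK orbC aS.
Qed.

Section Generating.
Variables (S : {fset gT}) (S_gen : generating_set S).

Lemma has_word_ex g : exists n, has_word S g n.
Proof.
have : generated [set` S] g by rewrite S_gen.
apply: (generated_sub (B := [set g | exists n, has_word S g n])).
  split; first by apply/mem_set; exists 0%N; exact: has_word1.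
  move=> x y /set_mem[m xm] /set_mem[n yn]; apply/mem_set; exists (m + n)%N.
  exact/has_wordM/has_wordV.
by move=> x xS; exists 1%N, [:: x]; rewrite /= big_seq1 (xS : x \in S).
Qed.

Lemma word_lengthP g : has_word S g (word_length S g) /\
  forall m, has_word S g m -> (word_length S g <= m)%N.
Proof.
have [n gn] := has_word_ex g.
have ex : exists n, `[< has_word S g n >] by exists n; apply/asboolP.
rewrite /word_length; case: xgetP => [m _ //|/(_ (ex_minn ex)) []].
by case: ex_minnP => m /asboolP gm mm; split => // k gk; exact/mm/asboolP.
Qed.

Lemma word_length_le g m : has_word S g m -> (word_length S g <= m)%N.
Proof. exact: (word_lengthP g).2. Qed.

Lemma word_length1 : word_length S 1 = 0%N.
Proof. by apply/eqP; rewrite -leqn0 word_length_le//; exact: has_word1. Qed.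

Lemma word_length_gt0 g : g <> 1 -> (0 < word_length S g)%N.
Proof.
move=> g1; rewrite lt0n; apply/eqP => g0.
have [w [_ + wg]] := (word_lengthP g).1.
by rewrite g0 => /size0nil w0; apply: g1; rewrite -wg w0 big_nil.
Qed.

Lemma word_lengthM x y :
  (word_length S (x * y) <= word_length S x + word_length S y)%N.
Proof.
by apply/word_length_le/has_wordM; [exact: (word_lengthP x).1|
  exact: (word_lengthP y).1].
Qed.

Lemma word_lengthV x : (word_length S x^-1 <= word_length S x)%N.
Proof. exact/word_length_le/has_wordV/(word_lengthP x).1. Qed.

End Generating.

End WordLength.

(** Bound the images of the letters of a shortest word one by one. This serves for automorphisms,
    where [K] is the norm, and for the identity map between two generating sets of one group. *)
Lemma word_length_hom_le (gT rT : groupType) (S : {fset gT}) (S' : {fset rT})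
    (f : gT -> rT) (K : nat) :
    generating_set S -> generating_set S' -> {morph f : x y / x * y}%g ->
    (forall s, s \in S -> word_length S' (f s) <= K)%N ->
  forall g, (word_length S' (f g) <= K * word_length S g)%N.
Proof.
move=> gS gS' fM fK g.
have f1 : f 1%g = 1%g by apply: (mulgI (f 1%g)); rewrite -fM !mulg1.
have fV x : f x^-1%g = (f x)^-1%g by apply: (mulgI (f x)); rewrite -fM !mulgV f1.
have [w [wS <- <-]] := (word_lengthP gS g).1.
elim: w wS => [|a w IH] /=.
  by move=> _; rewrite big_nil f1 (word_length1 gS').
move=> /andP[aS /IH wS]; rewrite big_cons fM mulnS.
apply: leq_trans (word_lengthM gS' _ _) (leq_add _ wS).
case/orP: aS => [/fK//|/fK]; rewrite fV; apply: leq_trans.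
by rewrite -[in X in (X <= _)%N](invgK (f a)) word_lengthV.
Qed.

Section AutNorm.
Local Open Scope group_scope.
Variables (G : groupType) (S : {fset G}) (S_gen : generating_set S).
Implicit Types f h : aut G.

Lemma aut_norm_le f g : (word_length S (f g) <= aut_norm S f * word_length S g)%N.
Proof.
apply: (word_length_hom_le S_gen S_gen (aut_morph f)) => s sS.
exact: (@leq_bigmax_seq _ (enum_fset S) xpredT (fun s => word_length S (f s)) s sS isT).
Qed.

Lemma aut_normM f h : (aut_norm S (f * h)%g <= aut_norm S f * aut_norm S h)%N.
Proof.
apply/bigmax_leqP_seq => s sS _; apply: leq_trans (aut_norm_le f (h s)) _.
rewrite leq_mul2l; apply/orP; right.
exact: (@leq_bigmax_seq _ (enum_fset S) xpredT (fun s => word_length S (h s)) s sS isT).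
Qed.

Lemma aut_norm1 : (aut_norm S 1%g <= 1)%N.
Proof.
apply/bigmax_leqP_seq => s sS _; apply: word_length_le => //.
by exists [:: s]; rewrite /= big_seq1 sS.
Qed.

(** An automorphism sends g <> 1 to a nontrivial element, whose positive length is at most the norm
    times the length of g. *)
Lemma aut_norm_gt0 f : (exists g : G, g <> 1) -> (0 < aut_norm S f)%N.
Proof.
move=> [g g1]; suff : (0 < aut_norm S f * word_length S g)%N.
  by rewrite muln_gt0 => /andP[].
apply: leq_trans (aut_norm_le f g); apply: word_length_gt0 => // fg.
apply: g1; apply: (bij_inj (aut_bij f)); rewrite fg.
by apply: (mulgI (f 1)); rewrite -(aut_morph f) !mulg1.
Qed.

End AutNorm.

(** * Sums of finitely supported functions *)

Section FiniteSums.
Variables (R : realType) (I : choiceType).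
Implicit Types f h : I -> R.

Definition fin_supp f := exists X : {fset I}, forall i, i \notin X -> f i = 0.

Lemma fin_supp_sub f h :
  fin_supp f -> (forall i, f i = 0 -> h i = 0) -> fin_supp h.
Proof. by move=> [X fX] fh; exists X => i /fX/fh. Qed.

Lemma fin_suppD f h : fin_supp f -> fin_supp h -> fin_supp (fun i => f i + h i).
Proof.
move=> [X fX] [Y hY]; exists (X `|` Y)%fset => i.
by rewrite in_fsetU negb_or => /andP[/fX -> /hY ->]; rewrite addr0.
Qed.

Lemma fin_suppZ c f : fin_supp f -> fin_supp (fun i => c * f i).
Proof. by move=> fs; apply: fin_supp_sub fs _ => i ->; rewrite mulr0. Qed.

Lemma fin_supp_sum (J : finType) (f : J -> I -> R) :
  (forall j, fin_supp (f j)) -> fin_supp (fun i => \sum_j f j i).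
Proof.
move=> fs; suff H r : fin_supp (fun i => \sum_(j <- r) f j i) by exact: H.
elim: r => [|j r IH].
  by exists fset0 => i _; rewrite big_nil.
by apply: fin_supp_sub (fin_suppD (fs j) IH) _ => i fi; rewrite big_cons.
Qed.

(** The value defaults to 0 when the support is infinite, hence the [fin_supp] side conditions of
    the rules below. *)
Definition fsum f : R := \sum_(i \in [set: I]) f i.

Lemma fsumE (X : {fset I}) f :
  (forall i, i \notin X -> f i = 0) -> fsum f = \sum_(i <- X) f i.
Proof. exact: fsbigTE. Qed.

Lemma eq_fsum f h : f =1 h -> fsum f = fsum h.
Proof. by move=> /funext ->. Qed.

Lemma fsumD f h : fin_supp f -> fin_supp h ->
  fsum (fun i => f i + h i) = fsum f + fsum h.
Proof.
move=> [X fX] [Y hY].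
have XY i : i \notin (X `|` Y)%fset -> f i = 0 /\ h i = 0.
  by rewrite in_fsetU negb_or => /andP[/fX fi /hY hi].
rewrite !(@fsumE (X `|` Y)%fset) ?big_split// => i /XY[fi hi] //.
by rewrite fi hi addr0.
Qed.

Lemma fsumZ c f : fin_supp f -> fsum (fun i => c * f i) = c * fsum f.
Proof.
move=> [X fX]; rewrite !(@fsumE X) ?mulr_sumr// => i /fX// ->.
by rewrite mulr0.
Qed.

Lemma fsumB f h : fin_supp f -> fin_supp h ->
  fsum (fun i => f i - h i) = fsum f - fsum h.
Proof.
move=> ff fh; rewrite -[X in _ = _ + X]mulN1r -fsumZ// -fsumD//; last first.
  exact: fin_suppZ.
by apply: eq_fsum => i; rewrite mulN1r.
Qed.

Lemma fsum_sum (J : finType) (f : J -> I -> R) :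
  (forall j, fin_supp (f j)) -> fsum (fun i => \sum_j f j i) = \sum_j fsum (f j).
Proof.
move=> fs; have [X fX] : exists X : {fset I}, forall j i, i \notin X -> f j i = 0.
  have [X fX] := choice fs; exists (\big[fsetU/fset0]_j X j)%fset => j i iX.
  apply: fX; apply: contraNN iX => iX; apply/bigfcupP; exists j => //.
  by rewrite mem_index_enum.
rewrite (@fsumE X); last by move=> i iX; apply: big1 => j _; exact: fX.
by rewrite exchange_big; apply: eq_bigr => j _; rewrite (@fsumE X)// => i; apply: fX.
Qed.

Lemma fsum_ge0 f : (forall i, 0 <= f i) -> 0 <= fsum f.
Proof. by move=> f0; apply: fsumr_ge0. Qed.

Lemma ler_fsum f h : fin_supp f -> fin_supp h -> (forall i, f i <= h i) ->
  fsum f <= fsum h.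
Proof.
move=> ff fh fleh; rewrite -subr_ge0 -fsumB//; apply: fsum_ge0 => i.
by rewrite subr_ge0.
Qed.

Lemma ler_norm_fsum f : fin_supp f -> `|fsum f| <= fsum (fun i => `|f i|).
Proof.
move=> [X fX]; rewrite !(@fsumE X)//; first exact: ler_norm_sum.
by move=> i /fX ->; rewrite normr0.
Qed.

Lemma fsum_delta x f : fsum (fun i => (i == x)%:R * f i) = f x.
Proof.
rewrite (@fsumE [fset x]%fset) ?big_seq_fset1 ?eqxx ?mul1r// => i.
by rewrite in_fset1 => /negPf ->; rewrite mul0r.
Qed.

End FiniteSums.

Section GroupSums.
Local Open Scope group_scope.
Variables (R : realType) (hT : groupType).
Implicit Types f : hT -> R.

Lemma mulg_bij (a : hT) : bijective ( *%g a).
Proof. by exists ( *%g a^-1); [exact: mulKg | exact: mulVKg]. Qed.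

Lemma fin_supp_mulg (a : hT) f : fin_supp f -> fin_supp (fun g => f (a * g)).
Proof.
move=> [X fX]; exists [fset a^-1 * x | x in X]%fset => g gX; apply: fX.
by apply: contraNN gX => agX; apply/imfsetP; exists (a * g) => //=; rewrite mulKg.
Qed.

Lemma fsum_mulg (a : hT) f : fsum (fun g => f (a * g)) = fsum f.
Proof. by rewrite /fsum [RHS](reindex_fsbigT ( *%g a))//; exact: mulg_bij. Qed.

End GroupSums.

(** * Slow decay of the simple random walk implies amenability *)

Lemma fmap_ultra (T U : Type) (f : T -> U) (F : set_system T) :
  UltraFilter F -> UltraFilter (fmap f F).
Proof.
move=> FU; split=> [|G GP FG]; first exact: fmap_proper_filter.
apply/seteqP; split=> // A GA.
have [//|FnA] := in_ultra_setVsetC (f @^-1` A) FU.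
have GnA : G (~` A) by apply: FG.
by case: (@filter_not_empty _ G GP); rewrite -(setICr A); exact: filterI.
Qed.

(** The image ultrafilter contains the compact segment [0, 1], so it converges there. *)
Lemma bounded_ultra_cvg (R : realType) (F : set_system nat) (u : nat -> R) :
  UltraFilter F -> (forall n, 0 <= u n <= 1) -> cvg (u x @[x --> F]).
Proof.
move=> FU u01; have /= := @segment_compact R 0 1.
rewrite compact_ultra => /(_ _ (fmap_ultra u FU)) [|l [_ ul]].
  have UP : ProperFilter F by exact: ultra_proper.
  by apply: (@filterE _ F) => n /=; rewrite in_itv /= u01.
by apply/cvg_ex; exists l.
Qed.

Lemma letter_invK (X : finType) : involutive (@letter_inv X).
Proof. by move=> [x b]; rewrite /letter_inv /= negbK. Qed.

Lemma card_letter (X : finType) : #|{: letter X}| = (2 * #|X|)%N.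
Proof. by rewrite card_prod card_bool mulnC. Qed.

Section Letters.
Variables (hT : groupType) (T : {fset hT}).
Local Notation L := (letter T).

Lemma letter_valV (a : L) : letter_val (letter_inv a) = ((letter_val a)^-1)%g.
Proof. by case: a => [x []] //=; rewrite /letter_val /= invgK. Qed.

Lemma generated_letter_val (a : L) : generated [set` T] (letter_val a).
Proof.
have xT (x : T) : generated [set` T] (val x) by have := @sub_gen_smallest _ (@subgroup hT) [set` T] (val x) (valP x).
case: a => [x []]; first exact: xT.
by apply: (subgroupV (generated_group _)); exact: xT.
Qed.

(** The elements that map [B] into itself by left translation, together with their inverses, form a
    subgroup; it contains [T] because letters come with both signs. *)
Lemma generated_letter (B : set hT) :
  B 1%g -> (forall (a : L) g, B g -> B (letter_val a * g)%g) ->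
  generated [set` T] `<=` B.
Proof.
move=> B1 BM g gT.
suff H : generated [set` T] `<=` [set g | forall b, B b -> B (g * b)%g].
  by rewrite -(mulg1 g); exact: H.
have TV h : h \in T -> forall b, B b -> B (h * b)%g /\ B (h^-1 * b)%g.
  move=> hT' b Bb.
  by split; [exact: (BM ([` hT']%fset, true)) | exact: (BM ([` hT']%fset, false))].
pose C := [set g | forall b, B b -> B (g * b)%g /\ B (g^-1 * b)%g].
suff H : generated [set` T] `<=` C by move=> h /H Ch b /Ch[].
apply: generated_sub => [|h hT' b /(TV h hT')//].
split; first by apply/mem_set => b Bb; rewrite invg1 !mul1g.
move=> x y /set_mem Cx /set_mem Cy; apply/mem_set => b Bb.
rewrite invgM invgK -!mulgA; split.
  by apply: (Cx _ _).1; apply: (Cy _ _).2.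
by apply: (Cy _ _).1; apply: (Cx _ _).2.
Qed.

End Letters.

Section SimpleWalk.
Variables (R : realType) (hT : groupType) (T : {fset hT}).
Local Notation L := (letter T).
Hypothesis T_gt0 : (0 < #|{: T}|)%N.
Implicit Types (a b : L) (f F : hT -> R).

Let cL : R := #|{: L}|%:R.

Let cL_gt0 : 0 < cL.
Proof. by rewrite ltr0n card_letter muln_gt0. Qed.

(** The Markov operator of the simple random walk, stepping on the left. It acts on densities and on
    observables alike, as the set of letters is symmetric. *)
Definition avg f (g : hT) : R := cL^-1 * \sum_(a : L) f (letter_val a * g)%g.

(* [srw n g] is the probability that n independent uniform letters multiply
   to g. *)
Definition srw (n : nat) : hT -> R := iter n avg (fun g => (g == 1%g)%:R).

Lemma fin_supp_avg f : fin_supp f -> fin_supp (avg f).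
Proof. by move=> fs; apply/fin_suppZ/fin_supp_sum => a; exact: fin_supp_mulg. Qed.

Lemma fin_supp_srw n : fin_supp (srw n).
Proof.
elim: n => [|n IH] /=; last exact: fin_supp_avg.
by exists [fset 1%g]%fset => g; rewrite in_fset1 => /negPf ->.
Qed.

Lemma srw_ge0 n g : 0 <= srw n g.
Proof.
elim: n g => [|n IH] g /=; first exact: ler0n.
by apply: mulr_ge0; [rewrite invr_ge0 ltW | exact: sumr_ge0].
Qed.

Lemma sum_letterV (F : L -> R) : \sum_(a : L) F (letter_inv a) = \sum_(a : L) F a.
Proof.
by rewrite [RHS](reindex_inj (inv_inj (@letter_invK T))).
Qed.

(** Self-adjointness: translating the sum by a letter moves its inverse onto the other factor, and
    inversion permutes the letters. *)
Lemma avg_adj f F : fin_supp f ->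
  fsum (fun g => avg f g * F g) = fsum (fun g => f g * avg F g).
Proof.
move=> fs; rewrite /avg.
transitivity (cL^-1 * \sum_(a : L) fsum (fun g => f (letter_val a * g)%g * F g)).
  rewrite -fsum_sum => [|a]; last first.
    by apply: fin_supp_sub (fin_supp_mulg (letter_val a) fs) _ => g ->; rewrite mul0r.
  rewrite -fsumZ; last first.
    apply: fin_supp_sum => a.
    by apply: fin_supp_sub (fin_supp_mulg (letter_val a) fs) _ => g ->; rewrite mul0r.
  by apply: eq_fsum => g; rewrite -mulrA mulr_suml.
transitivity (cL^-1 * \sum_(a : L) fsum (fun g => f g * F (letter_val a * g)%g)); last first.
  rewrite -fsum_sum => [|a]; last by apply: fin_supp_sub fs _ => g ->; rewrite mul0r.
  rewrite -fsumZ; last first.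
    by apply: fin_supp_sum => a; apply: fin_supp_sub fs _ => g ->; rewrite mul0r.
  by apply: eq_fsum => g; rewrite mulrCA -mulr_sumr.
congr (_ * _); rewrite -[RHS]sum_letterV; apply: eq_bigr => a _.
rewrite -[RHS](fsum_mulg (letter_val a)); apply: eq_fsum => g.
by rewrite letter_valV mulKg.
Qed.

Lemma fsum_srw n F : fsum (fun g => srw n g * F g) = iter n avg F 1%g.
Proof.
elim: n F => [|n IH] F /=; first exact: fsum_delta.
by rewrite avg_adj ?IH -?iterSr//; exact: fin_supp_srw.
Qed.

Lemma avg_cst (c : R) : avg (fun=> c) = fun=> c.
Proof.
apply/funext => g; rewrite /avg sumr_const.
by rewrite -[c *+ _]mulr_natl mulrA mulVf ?mul1r// gt_eqF.
Qed.

Lemma fsum_srw1 n : fsum (srw n) = 1.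
Proof.
transitivity (fsum (fun g => srw n g * 1)).
  by apply: eq_fsum => g; rewrite mulr1.
rewrite (fsum_srw n (fun=> 1)); suff -> : iter n avg (fun=> 1) = fun=> 1 by [].
by elim: n => //= n ->; exact: avg_cst.
Qed.

Lemma srw_generated n g : ~ generated [set` T] g -> srw n g = 0.
Proof.
elim: n g => [|n IH] g ngT /=.
  case: eqP => // g1; exfalso; apply: ngT; rewrite g1.
  exact: subgroup1 (generated_group _).
rewrite /avg big1 ?mulr0// => a _; apply: IH => agT; apply: ngT.
rewrite -(mulKg (letter_val a) g) -letter_valV.
have GT := generated_group [set` T].
by apply: (subgroupM GT) => //; exact: generated_letter_val.
Qed.

(** By symmetry of the walk this is also its return probability at time 2n. *)
Definition srw2 n := fsum (fun g => srw n g ^+ 2).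

Lemma fin_supp_srwM m n : fin_supp (fun g => srw m g * srw n g).
Proof. by apply: fin_supp_sub (fin_supp_srw m) _ => g ->; rewrite mul0r. Qed.

Lemma srw2_ge0 n : 0 <= srw2 n.
Proof. by apply: fsum_ge0 => g; exact: sqr_ge0. Qed.

Lemma srw2_gt0 n : 0 < srw2 n.
Proof.
rewrite lt_neqAle srw2_ge0 andbT; apply/eqP => q0.
have [X sX] := fin_supp_srw n.
have : fsum (srw n) = 1 by exact: fsum_srw1.
rewrite (@fsumE _ _ X)// big1_seq ?(eqP (oner_neq0 _)) => [/eqP|g /= gX].
  by rewrite eq_sym oner_eq0.
apply/eqP; rewrite -sqrf_eq0; apply/eqP.
have := esym q0; rewrite /srw2 (@fsumE _ _ X) => [/eqP|i /sX ->]; last by rewrite expr0n.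
rewrite psumr_eq0 => [/allP /(_ g gX)/eqP //|i _]; exact: sqr_ge0.
Qed.

Lemma fin_supp_defect n b : fin_supp (fun g => (srw n (letter_val b * g)%g - srw n.+1 g) ^+ 2).
Proof.
apply: fin_supp_sub (fin_suppD (fin_supp_mulg (letter_val b)
  (fin_supp_srwM n n)) (fin_supp_srwM n.+1 n.+1)) _ => g /eqP.
rewrite -!expr2 paddr_eq0 ?sqr_ge0// !sqrf_eq0 => /andP[/eqP-> /eqP->].
by rewrite subr0 expr0n.
Qed.

(* The average of the translates of [srw n] is [srw n.+1], so the squared
   distances to it add up to the loss of squared norm. *)
Lemma srw_defect n :
  \sum_(b : L) fsum (fun g => (srw n (letter_val b * g)%g - srw n.+1 g) ^+ 2)
  = cL * (srw2 n - srw2 n.+1).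
Proof.
have fm b : fin_supp (fun g => srw n (letter_val b * g)%g * srw n.+1 g).
  by apply: fin_supp_sub (fin_supp_srw n.+1) _ => g ->; rewrite mulr0.
have fs b : fin_supp (fun g => srw n (letter_val b * g)%g ^+ 2).
  exact: (fin_supp_mulg (letter_val b) (fin_supp_srwM n n)).
transitivity (\sum_(b : L) (srw2 n + srw2 n.+1 -
    2 * fsum (fun g => srw n (letter_val b * g)%g * srw n.+1 g))).
  apply: eq_bigr => b _.
  rewrite /srw2 -[X in X + _ - _](fsum_mulg (letter_val b)).
  rewrite -fsumD//; last exact: fin_supp_srwM.
  rewrite -fsumZ// -fsumB; last exact: fin_suppZ.
    by apply: eq_fsum => g; ring.
  by apply: fin_suppD => //; exact: fin_supp_srwM.
rewrite sumrB sumr_const -mulr_sumr -fsum_sum//.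
have -> : fsum (fun g => \sum_(b : L) srw n (letter_val b * g)%g * srw n.+1 g)
    = cL * srw2 n.+1.
  rewrite -fsumZ; last exact: fin_supp_srwM.
  apply: eq_fsum => g; rewrite -mulr_suml expr2 mulrA; congr (_ * _).
  by rewrite /= /avg mulVKf// gt_eqF.
by rewrite -[(_ + _) *+ _]mulr_natl -/cL; ring.
Qed.

(** A translate of [srw n] by a letter is close to [srw n.+1], and a translate of [srw n.+1] is
    close to [srw n]. Summing over two consecutive times makes the weight almost invariant even when
    parity separates the two. *)
Definition srw_weight n g := srw n g ^+ 2 + srw n.+1 g ^+ 2.
Definition srw_mean n (A : set hT) : R :=
  fsum (fun g => srw_weight n g * (g \in A)%:R) / (srw2 n + srw2 n.+1).

Lemma fin_supp_weight n : fin_supp (srw_weight n).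
Proof. exact: fin_suppD (fin_supp_srwM _ _) (fin_supp_srwM _ _). Qed.

Lemma weight_ge0 n g : 0 <= srw_weight n g.
Proof. by rewrite addr_ge0 ?sqr_ge0. Qed.

Lemma srw_mean01 n A : 0 <= srw_mean n A <= 1.
Proof.
have q0 : 0 < srw2 n + srw2 n.+1 by rewrite addr_gt0 ?srw2_gt0.
rewrite divr_ge0 ?(ltW q0)//=; last first.
  by apply: fsum_ge0 => g; rewrite mulr_ge0 ?weight_ge0.
rewrite ler_pdivrMr// mul1r -fsumD; [|exact: fin_supp_srwM..].
apply: ler_fsum => [||g]; last by rewrite ler_piMr ?weight_ge0// lern1 leq_b1.
  by apply: fin_supp_sub (fin_supp_weight n) _ => g ->; rewrite mul0r.
exact: fin_supp_weight.
Qed.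

Lemma srw_meanU n A B : A `&` B = set0 ->
  srw_mean n (A `|` B) = srw_mean n A + srw_mean n B.
Proof.
move=> AB; rewrite /srw_mean -mulrDl; congr (_ / _); rewrite -fsumD.
- apply: eq_fsum => g; rewrite -mulrDr; congr (_ * _).
  rewrite in_setU; have [gA|gA] := boolP (g \in A); have [gB|gB] := boolP (g \in B);
    rewrite /= ?addr0 ?add0r//.
  have : (A `&` B) g by split; exact/set_mem.
  by rewrite AB.
- by apply: fin_supp_sub (fin_supp_weight n) _ => g ->; rewrite mul0r.
- by apply: fin_supp_sub (fin_supp_weight n) _ => g ->; rewrite mul0r.
Qed.

Lemma srw_mean_generated n : srw_mean n (generated [set` T]) = 1.
Proof.
rewrite /srw_mean (_ : fsum _ = srw2 n + srw2 n.+1); last first.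
  rewrite -fsumD; [|exact: fin_supp_srwM..].
  apply: eq_fsum => g; have [_|] := boolP (g \in _); first by rewrite mulr1.
  by rewrite notin_setE mulr0 => gT; rewrite !srw_generated// expr0n addr0.
by rewrite divff// gt_eqF// addr_gt0 ?srw2_gt0.
Qed.

(** Factor the difference as (x - y)(x + y), apply the weighted inequality between arithmetic and
    geometric means, and bound (x + y)^2 by 2(x^2 + y^2). *)
Lemma sqr_diff_le (eta x y : R) : 0 < eta ->
  `|x ^+ 2 - y ^+ 2| <= eta^-1 / 2 * (x - y) ^+ 2 + eta * (x ^+ 2 + y ^+ 2).
Proof.
move=> e0; rewrite subr_sqr normrM.
have e1 : eta^-1 * eta = 1 by rewrite mulVf// gt_eqF.
pose u := eta^-1 * `|x - y|.
have xy : `|x - y| = eta * u by rewrite mulrA mulfV ?mul1r ?gt_eqF.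
have -> : eta^-1 / 2 * (x - y) ^+ 2 = eta * u ^+ 2 / 2.
  rewrite -(real_normK (num_real (x - y))) xy.
  by transitivity ((eta^-1 * eta) * (eta * u ^+ 2 / 2)); [ring | rewrite e1 mul1r].
rewrite xy.
have : 0 <= (u - `|x + y|) ^+ 2 by exact: sqr_ge0.
have : `|x + y| ^+ 2 = (x + y) ^+ 2 by rewrite real_normK ?num_real.
set w := `|x + y|; move=> w2 h.
have : u * w <= u ^+ 2 / 2 + (x ^+ 2 + y ^+ 2).
  have : 0 <= (x - y) ^+ 2 by exact: sqr_ge0.
  by move: w2 h; nra.
by nra.
Qed.

(** The hypothesis makes the loss of squared norm at most [eta ^+ 2 * srw2 n], so by [srw_defect]
    all translates of [srw n] lie near [srw n.+1]; [sqr_diff_le] turns this into closeness of the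
    squares in l1. *)
Lemma srw_mean_letter n (eta : R) b A : 0 < eta ->
    (1 - eta ^+ 2) * srw2 n <= srw2 n.+1 ->
  `|srw_mean n [set (letter_val b * x)%g | x in A] - srw_mean n A|
  <= (cL + 2) * eta.
Proof.
move=> e0 qn; have q0 : 0 < srw2 n + srw2 n.+1 by rewrite addr_gt0 ?srw2_gt0.
rewrite /srw_mean -mulrBl normrM [X in _ * X]gtr0_norm ?invr_gt0//.
rewrite ler_pdivrMr//.
have -> : fsum (fun g => srw_weight n g * (g \in [set (letter_val b * x)%g | x in A])%:R)
  = fsum (fun g => srw_weight n (letter_val b * g)%g * (g \in A)%:R).
  rewrite -(fsum_mulg (letter_val b)); apply: eq_fsum => g; congr (_ * _%:R).
  congr nat_of_bool; apply/idP/idP => /set_mem.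
    by move=> [x Ax /mulgI <-]; exact/mem_set.
  by move=> Ag; apply/mem_set; exists g.
have fw : fin_supp (fun g => srw_weight n (letter_val b * g)%g).
  exact: (fin_supp_mulg (letter_val b) (fin_supp_weight n)).
have fd : fin_supp (fun g => srw_weight n (letter_val b * g)%g - srw_weight n g).
  have := fin_suppZ (-1) (fin_supp_weight n) => /(fin_suppD fw) fs.
  by apply: fin_supp_sub fs _ => g; rewrite mulN1r.
rewrite -fsumB.
- pose D a := fsum (fun g => (srw n (letter_val a * g)%g - srw n.+1 g) ^+ 2).
  have D0 a : 0 <= D a by apply: fsum_ge0 => g; exact: sqr_ge0.
  (* Each [D a] is one nonnegative summand of [srw_defect]. *)
  have DL a : D a <= cL * eta ^+ 2 * srw2 n.
    rewrite -mulrA; apply: (@le_trans _ _ (cL * (srw2 n - srw2 n.+1))).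
      by rewrite -srw_defect (bigD1 a)//= -/(D a) lerDl sumr_ge0// => c _; exact: D0.
    by rewrite ler_pM2l//; lra.
  apply: le_trans (ler_norm_fsum _) _.
    by apply: fin_supp_sub fd _ => g; rewrite -mulrBl => ->; rewrite mul0r.
  (* The pairing is crossed: [U1] compares the translate at time n with time n+1, and [U2] the
     translate at time n+1 with time n. *)
  pose U1 g := eta^-1 / 2 * (srw n (letter_val b * g)%g - srw n.+1 g) ^+ 2
    + eta * (srw n (letter_val b * g)%g ^+ 2 + srw n.+1 g ^+ 2).
  pose U2 g := eta^-1 / 2 * (srw n.+1 (letter_val b * g)%g - srw n g) ^+ 2
    + eta * (srw n.+1 (letter_val b * g)%g ^+ 2 + srw n g ^+ 2).
  have s2 m : fin_supp (fun g => srw m g ^+ 2) by exact: fin_supp_srwM.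
  have t2 m : fin_supp (fun g => srw m (letter_val b * g)%g ^+ 2).
    exact: (fin_supp_mulg (letter_val b) (s2 m)).
  have fd1 := fin_supp_defect n b.
  have fd2 : fin_supp (fun g => (srw n.+1 (letter_val b * g)%g - srw n g) ^+ 2).
    apply: fin_supp_sub (fin_supp_mulg (letter_val b)
      (fin_supp_defect n (letter_inv b))) _ => g.
    by rewrite letter_valV mulKg => <-; rewrite -sqrrN opprB.
  have fU1 : fin_supp U1.
    by apply: fin_suppD; apply: fin_suppZ => //; exact: fin_suppD.
  have fU2 : fin_supp U2.
    by apply: fin_suppD; apply: fin_suppZ => //; exact: fin_suppD.
  apply: (@le_trans _ _ (fsum (fun g => U1 g + U2 g))).
    apply: ler_fsum => [||g]; last first.
    + rewrite -mulrBl normrM; apply: (@le_trans _ _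
        `|srw_weight n (letter_val b * g)%g - srw_weight n g|).
        by rewrite ler_piMr// normr_nat lern1 leq_b1.
      rewrite /srw_weight [X in `|X|](_ : _ =
        (srw n (letter_val b * g)%g ^+ 2 - srw n.+1 g ^+ 2) +
        (srw n.+1 (letter_val b * g)%g ^+ 2 - srw n g ^+ 2)); last by ring.
      by apply: le_trans (ler_normD _ _) _; apply: lerD; exact: sqr_diff_le.
    + exact: fin_suppD.
    + by apply: fin_supp_sub fd _ => g; rewrite -mulrBl => ->; rewrite mul0r normr0.
  have E1 : fsum U1 = eta^-1 / 2 * D b + eta * (srw2 n + srw2 n.+1).
    rewrite fsumD; [|exact: fin_suppZ|by apply/fin_suppZ/fin_suppD].
    rewrite !fsumZ//; last exact: fin_suppD.
    by rewrite fsumD// (fsum_mulg (letter_val b) (fun g => srw n g ^+ 2)).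
  (* Translating back by the inverse letter turns the second distance into [D (letter_inv b)]. *)
  have E2 : fsum U2 = eta^-1 / 2 * D (letter_inv b) + eta * (srw2 n + srw2 n.+1).
    rewrite fsumD; [|exact: fin_suppZ|by apply/fin_suppZ/fin_suppD].
    rewrite !fsumZ//; last exact: fin_suppD.
    rewrite fsumD// (fsum_mulg (letter_val b) (fun g => srw n.+1 g ^+ 2)).
    rewrite [srw2 n.+1 + _]addrC; congr (_ * _ + _).
    rewrite -[RHS](fsum_mulg (letter_val b)); apply: eq_fsum => g.
    by rewrite letter_valV mulKg -sqrrN opprB.
  rewrite fsumD// E1 E2.
  have d1 : eta^-1 * D b <= cL * eta * srw2 n.
    by rewrite mulrC ler_pdivrMr//; have := DL b; lra.
  have d2 : eta^-1 * D (letter_inv b) <= cL * eta * srw2 n.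
    by rewrite mulrC ler_pdivrMr//; have := DL (letter_inv b); lra.
  have : 0 <= cL * eta * srw2 n.+1 by rewrite !mulr_ge0 ?srw2_ge0// ltW.
  lra.
- by apply: fin_supp_sub fw _ => g ->; rewrite mul0r.
- by apply: fin_supp_sub (fin_supp_weight n) _ => g ->; rewrite mul0r.
Qed.

(** If the squared norm shrank by more than the factor [r] at every step, then, starting from 1 at
    time 0, it would stay below [r ^+ n]. *)
Lemma srw2_slow (r : R) : 0 < r ->
  (exists n, r ^+ n < srw2 n) -> exists n, r * srw2 n <= srw2 n.+1.
Proof.
move=> r0 [n]; apply: contraPP => /forallNP H; apply/negP; rewrite -leNgt.
elim: n => [|n IH].
  rewrite expr0 /srw2 (eq_fsum (h := fun g => (g == 1%g)%:R * (g == 1%g)%:R)).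
    by rewrite fsum_delta eqxx.
  by move=> g; rewrite expr2.
rewrite exprS; apply: (@le_trans _ _ (r * srw2 n)); last by rewrite ler_pM2l.
by rewrite ltW// ltNge; apply/negP/H.
Qed.

Lemma amenable_of_slow_decay :
  (forall r : R, 0 < r < 1 -> exists n, r ^+ n < srw2 n) ->
  amenable R (generated [set` T]).
Proof.
move=> slow.
(* The shift by 2 keeps [e j] below 1, so that the ratio [1 - e j ^+ 2] lies strictly between 0 and
   1. *)
pose e (j : nat) : R := j.+2%:R^-1.
have e0 j : 0 < e j by rewrite invr_gt0 ltr0n.
have e1 j : e j < 1 by rewrite invf_lt1 ?ltr0n// ltr1n.
have /choice[N NP] j : exists n, (1 - e j ^+ 2) * srw2 n <= srw2 n.+1.
  have r0 : 0 < 1 - e j ^+ 2 by rewrite subr_gt0 expr_lt1// ltW.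
  by apply: srw2_slow => //; apply: slow; rewrite r0 ltrBlDr ltrDl exprn_gt0.
(* Limits along an ultrafilter exist for every set [A] at once and are additive. Only the errors
   [e j] have to tend to 0; the times [N j] may be arbitrary. *)
have [U [UU Uoo]] := ultraFilterLemma (eventually_filter).
pose m A j := srw_mean (N j) A.
pose mu A := lim (m A j @[j --> U]).
have mc A : m A j @[j --> U] --> mu A.
  by apply: bounded_ultra_cvg => j; exact: srw_mean01.
have UP : ProperFilter U by exact: ultra_proper.
have mu_letter b A : mu [set (letter_val b * x)%g | x in A] = mu A.
  apply/eqP; rewrite -subr_eq0; apply/eqP.
  have c1 : m [set (letter_val b * x)%g | x in A] j - m A j @[j --> U]
      --> mu [set (letter_val b * x)%g | x in A] - mu A by exact: cvgB.
  apply: (cvg_unique _ c1) => //; apply/norm_cvg0P.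
  apply: (@squeeze_cvgr _ _ _ _ (cst 0) (fun j => (cL + 2) * e j)).
  - by apply: nearW => j; rewrite normr_ge0/=; exact: srw_mean_letter.
  - exact: cvg_cst.
  - rewrite -(mulr0 (cL + 2)); apply: cvgM; first exact: cvg_cst.
    apply: cvg_trans (_ : e j @[j --> \oo] --> (0 : R)).
      exact: cvg_app.
    by have := @cvg_harmonic R; rewrite -cvg_shiftS.
exists mu; split.
- move=> A _; apply: (limr_ge (mc A)); apply: nearW => j.
  by case/andP: (srw_mean01 (N j) A).
- apply: cvg_lim => //; rewrite (_ : m _ = cst 1); first exact: cvg_cst.
  by apply/funext => j; exact: srw_mean_generated.
- move=> A B _ _ AB; apply: cvg_lim => //.
  rewrite (_ : m _ = m A \+ m B); first exact: cvgD.
  by apply/funext => j; exact: srw_meanU.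
- move=> h A hH _.
  (* Invariance under letters spreads to the subgroup they generate. *)
  suff : generated [set` T] `<=` [set h | mu [set (h * x)%g | x in A] = mu A].
    exact.
  apply: generated_letter => [|b g /= gA] /=.
    by congr mu; rewrite (_ : *%g 1%g = id) ?image_id//; apply/funext => x; exact: mul1g.
  rewrite -[RHS]gA -[RHS](mu_letter b); congr mu; rewrite [RHS]image_comp.
  by congr (image _ _); apply/funext => x /=; rewrite mulgA.
Qed.

End SimpleWalk.

(** * Non-backtracking means *)

Section NonBacktracking.
Variables (R : realType) (hT : groupType) (T : {fset hT}).
Local Notation L := (letter T).
Hypothesis T_gt0 : (0 < #|{: T}|)%N.
Implicit Types (a b : L) (F : hT -> R).

Let q : R := (2 * #|{: T}| - 1)%N%:R.

Let q_gt0 : 0 < q.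
Proof. by rewrite ltr0n; lia. Qed.

Let card_q : #|{: L}|%:R = q + 1.
Proof.
by rewrite card_letter /q natr1 subn1 prednK// muln_gt0.
Qed.

(* [nb_cont n a F] is the mean of [F] over the values of the uniform word of
   [n] letters among those that stay reduced when [a] is put in front. *)
Fixpoint nb_cont (n : nat) (a : L) F : R :=
  if n is m.+1 then
    q^-1 * \sum_(b : L | b != letter_inv a)
             nb_cont m b (fun g => F (letter_val b * g)%g)
  else F 1%g.

Definition nb_mean (n : nat) F : R :=
  if n is m.+1 then
    #|{: L}|%:R^-1 * \sum_(b : L) nb_cont m b (fun g => F (letter_val b * g)%g)
  else F 1%g.

Lemma sum_letter_neq a (x : R) : \sum_(b : L | b != a) x = q * x.
Proof.
rewrite sumr_const mulr_natl; congr (_ *+ _).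
have := cardC1 a; rewrite card_letter subn1 => <-.
by apply: eq_card => b; rewrite !inE.
Qed.

Lemma nb_contD n a F F' :
  nb_cont n a (fun g => F g + F' g) = nb_cont n a F + nb_cont n a F'.
Proof.
elim: n a F F' => [|n IH] a F F' //=.
by rewrite -mulrDr -big_split; congr (_ * _); apply: eq_bigr => b _; rewrite IH.
Qed.

Lemma nb_contZ n a c F : nb_cont n a (fun g => c * F g) = c * nb_cont n a F.
Proof.
elim: n a F => [|n IH] a F //=.
by rewrite [RHS]mulrCA [X in _ = _ * X]mulr_sumr; congr (_ * _); apply: eq_bigr => b _; rewrite IH.
Qed.

Lemma nb_cont_cst n a c : nb_cont n a (fun=> c) = c.
Proof.
elim: n a => [|n IH] a //=; under eq_bigr do rewrite IH.
by rewrite sum_letter_neq mulrA mulVf ?mul1r// gt_eqF.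
Qed.

Lemma nb_cont_sum (J : finType) n a (F : J -> hT -> R) :
  nb_cont n a (fun g => \sum_j F j g) = \sum_j nb_cont n a (F j).
Proof.
suff H r : nb_cont n a (fun g => \sum_(j <- r) F j g) =
           \sum_(j <- r) nb_cont n a (F j) by exact: H.
elim: r => [|j r IH].
  by under eq_fun do rewrite big_nil; rewrite big_nil nb_cont_cst.
by under eq_fun do rewrite big_cons; rewrite big_cons nb_contD IH.
Qed.

Lemma nb_cont_le n a F F' : (forall g, F g <= F' g) -> nb_cont n a F <= nb_cont n a F'.
Proof.
elim: n a F F' => [|n IH] a F F' FF' //=.
by rewrite ler_pM2l ?invr_gt0// ler_sum// => b _; apply: IH => g.
Qed.

(** Each letter may follow all letters but one, so the sum over [a] cancels the factor [q^-1]. *)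
Lemma sum_nb_cont n F : \sum_(a : L) nb_cont n a F = #|{: L}|%:R * nb_mean n F.
Proof.
case: n => [|n] /=; first by rewrite sumr_const mulr_natl.
rewrite mulrA mulfV ?mul1r; last by rewrite card_q gt_eqF// ltr_wpDr.
rewrite -mulr_sumr (exchange_big_dep xpredT)//= mulr_sumr.
apply: eq_bigr => b _.
rewrite (eq_bigl (fun a : L => a != letter_inv b)); last first.
  move=> a; apply/idP/idP; apply: contraNN => /eqP ->; rewrite letter_invK//.
by rewrite sum_letter_neq mulrA mulVf ?mul1r// gt_eqF.
Qed.

(** The recurrence of spheres in a regular tree: a uniform letter put before a reduced word of
    length n+1 lengthens it with probability q/(q+1), and otherwise cancels its first letter and
    leaves a uniform reduced word of length n. *)
Lemma nb_mean_avg n F : nb_mean n.+1 (avg T F) =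
  (q + 1)^-1 * (q * nb_mean n.+2 F + nb_mean n F).
Proof.
have q1 : q + 1 != 0 by rewrite gt_eqF// ltr_wpDr.
transitivity ((q + 1)^-1 * \sum_(c : L) ((q + 1)^-1 * \sum_(b : L)
    nb_cont n b (fun g => F (letter_val c * (letter_val b * g))%g))).
  rewrite /nb_mean /avg card_q; congr (_ * _).
  under eq_bigr do rewrite nb_contZ nb_cont_sum.
  by rewrite -mulr_sumr exchange_big/= mulr_sumr.
congr (_ * _); rewrite -mulr_sumr.
rewrite (eq_bigr (fun c => q * nb_cont n.+1 c (fun g => F (letter_val c * g)%g)
   + nb_cont n (letter_inv c) F)); last first.
  (* The letter [letter_inv c] is the one that cancels; the other letters give [nb_cont n.+1 c]. *)
  move=> c _; rewrite (bigD1 (letter_inv c))//= addrC mulrA mulfV ?mul1r ?gt_eqF//.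
  by congr (_ + _); congr nb_cont; apply/funext => g; rewrite letter_valV mulVKg.
rewrite big_split/= -mulr_sumr (sum_letterV (fun c => nb_cont n c F)) sum_nb_cont.
by rewrite card_q; field.
Qed.

Lemma nb_mean_ge0 n F : (forall g, 0 <= F g) -> 0 <= nb_mean n F.
Proof.
move=> F0; case: n => [|n]//=; rewrite mulr_ge0 ?invr_ge0// sumr_ge0// => b _.
by rewrite -[X in X <= _](nb_cont_cst n b); exact: nb_cont_le.
Qed.

Lemma nb_mean_le_linear n (C : R) F : F 1%g <= 0 ->
  (forall a g, F (letter_val a * g)%g <= C + F g) -> nb_mean n F <= C * n%:R.
Proof.
move=> F1 FC.
have H m a : nb_cont m a F <= C * m%:R.
  elim: m a => [|m IH] a /=; first by rewrite mulr0.
  rewrite mulrC ler_pdivrMr// mulrC -(sum_letter_neq (letter_inv a)) ler_sum// => b _.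
  apply: le_trans (nb_cont_le _ _ (FC b)) _.
  by rewrite nb_contD nb_cont_cst -natr1 mulrDr mulr1 addrC lerD2r.
case: n => [|n] /=; first by rewrite mulr0.
rewrite mulrC ler_pdivrMr; last by rewrite card_q ltr_wpDr.
rewrite mulrC [leRHS]mulr_natl -sumr_const ler_sum// => b _.
apply: le_trans (nb_cont_le _ _ (FC b)) _.
by rewrite nb_contD nb_cont_cst -natr1 mulrDr mulr1 addrC lerD2r.
Qed.

(* The simple random walk at time [n] is a mixture of the non-backtracking
   walks at times [m <= n]. *)
Lemma avg_le_nb_mean n F (c : R) :
  (forall m, (m <= n)%N -> nb_mean m F <= c) -> iter n (avg T) F 1%g <= c.
Proof.
(* Generalised to an initial length k: one averaging moves length m to m - 1 and m + 1, so n of them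
   stay within k + n. *)
suff H k : (forall m, (m <= k + n)%N -> nb_mean m F <= c) ->
  nb_mean k (iter n (avg T) F) <= c by exact: (H 0%N).
elim: n k F => [|n IH] k F Fc; first by apply: Fc; rewrite addn0.
rewrite iterSr; apply: IH => -[_|m mkn]; first by apply: (Fc 1%N); lia.
rewrite nb_mean_avg mulrC ler_pdivrMr; last by rewrite ltr_wpDr.
rewrite mulrDr mulr1 lerD//; last by apply: Fc; lia.
by rewrite mulrC ler_pM2r//; apply: Fc; lia.
Qed.

End NonBacktracking.

(** * Polynomial growth *)

Section LogNorm.
Variables (R : realType) (G : groupType) (S : {fset G}).
Hypotheses (G_nontrivial : exists g : G, g <> 1%g) (S_gen : generating_set S).
Implicit Types f h : aut G.

Definition log_norm f : R := ln (aut_norm S f)%:R.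

Let norm_gt0 f : 0 < (aut_norm S f)%:R :> R.
Proof. by rewrite ltr0n aut_norm_gt0. Qed.

Lemma log_norm_ge0 f : 0 <= log_norm f.
Proof. by rewrite ln_ge0// ler1n aut_norm_gt0. Qed.

Lemma log_norm1 : log_norm 1%g <= 0.
Proof. by rewrite ln_le0// lern1 aut_norm1. Qed.

Lemma log_normM f h : log_norm (f * h)%g <= log_norm f + log_norm h.
Proof.
by rewrite -lnM ?posrE// ler_ln ?posrE// ?mulr_gt0// -natrM ler_nat aut_normM.
Qed.

Lemma log_norm_le f x : (log_norm f <= x) = ((aut_norm S f)%:R <= expR x).
Proof. by rewrite -[in LHS](expRK x) ler_ln ?posrE ?expR_gt0//. Qed.

End LogNorm.

Section Growth.
Variables (R : realType) (G : groupType) (S : {fset G}).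
Hypotheses (G_nontrivial : exists g : G, g <> 1%g) (S_gen : generating_set S).

Lemma aut_eq_on_generators (f h : aut G) : {in S, f =1 h} -> f = h.
Proof.
move=> fh; apply: aut_ext => g.
have f1 (k : aut G) : k 1%g = 1%g by apply: (mulgI (k 1%g)); rewrite -aut_morph !mulg1.
have fV (k : aut G) x : k x^-1%g = (k x)^-1%g.
  by apply: (mulgI (k x)); rewrite -aut_morph !mulgV f1.
suff H : generated [set` S] `<=` [set g | f g = h g] by apply: H; rewrite S_gen.
apply: generated_sub => [|s sS]; last exact: fh.
split; first by apply/mem_set; rewrite /= !f1.
move=> x y /set_mem /= xfh /set_mem /= yfh; apply/mem_set.
by rewrite /= !aut_morph !fV xfh yfh.
Qed.

(* An automorphism is determined by its values on S, which lie in the ball of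
   radius the norm. *)
Lemma card_aut_norm_le : polynomial_growth G -> exists M D : nat,
  forall (W : {fset aut G}) (r : nat), (0 < r)%N ->
    (forall f, f \in W -> (aut_norm S f <= r)%N) -> (#|` W| <= M * r ^ D)%N.
Proof.
move=> [S' S'_gen [C [d ball]]].
(* The constant that compares the two generating sets; the successor makes it positive, since the
   growth bound speaks of positive radii. *)
pose K := (\max_(s <- S) word_length S' s).+1.
have KP g : (word_length S' g <= K * word_length S g)%N.
  apply: (word_length_hom_le S_gen S'_gen (f := id)) => // s sS.
  apply: leqW; exact: (@leq_bigmax_seq _ (enum_fset S) xpredT (word_length S') s).
exists ((C * K ^ d) ^ #|{: S}|)%N, (d * #|{: S}|)%N => W r r0 Wr.
have Kr0 : (0 < K * r)%N by rewrite muln_gt0.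
rewrite expnM -expnMn -mulnA -expnMn.
have /pcard_leP[e] := ball _ Kr0.
have eN g : word_ball S' (K * r) g -> (e g < C * (K * r) ^ d)%N by exact: (@funS _ _ _ _ e g).
have WB (f : W) (s : S) : word_ball S' (K * r) (val f (val s)).
  apply: leq_trans (KP _) _; rewrite leq_mul2l; apply/orP; right.
  apply: leq_trans (Wr _ (valP f)).
  exact: (@leq_bigmax_seq _ (enum_fset S) xpredT (fun s => word_length S (val f s)) (val s) (fsvalP s) isT).
rewrite cardfE -[X in (_ <= X ^ _)%N]card_ord.
pose E (f : W) := [ffun s : S => Ordinal (eN _ (WB f s))].
have E_inj : injective E.
  move=> f h /ffunP fh; apply/val_inj/aut_eq_on_generators => s sS.
  have := fh [` sS]%fset; rewrite !ffunE => -[].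
  by move/(@inj _ _ _ e); apply; apply/mem_set; [exact: (WB f [` sS]%fset)|exact: (WB h [` sS]%fset)].
by have := leq_card _ E_inj; rewrite card_ffun.
Qed.

Variable T : {fset aut G}.
Hypothesis T_gt0 : (0 < #|{: T}|)%N.
Local Notation log_norm := (@log_norm R G S).

Lemma log_norm_letter_le : exists2 C : R, 0 < C &
  forall a : letter T, log_norm (letter_val a) <= C.
Proof.
exists (1 + \sum_(a : letter T) log_norm (letter_val a)).
  by rewrite ltr_pwDl// sumr_ge0// => a _; exact: log_norm_ge0.
move=> a; rewrite (bigD1 a)//= addrCA lerDl addr_ge0// sumr_ge0// => b _.
exact: log_norm_ge0.
Qed.

(** The mixture also contains short lengths m < N, outside the range of the assumed bound. There the
    linear bound gives at most [C * N], which [eps * n] absorbs for large n. *)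
Lemma srw_log_norm (eps : R) : 0 < eps ->
    (forall eps : R, 0 < eps -> exists N, forall n, (N <= n)%N ->
       @nb_mean R _ T n log_norm <= eps * n%:R) ->
  exists N, forall n, (N <= n)%N ->
    fsum (fun f => srw R T n f * log_norm f) <= eps * n%:R.
Proof.
move=> e0 /(_ _ e0)[N NP]; have [C C0 CP] := log_norm_letter_le.
pose N' := (Num.truncn (C * N%:R / eps)).+1.
exists N' => n N'n; rewrite fsum_srw//; apply: avg_le_nb_mean => // m mn.
have [mN|Nm] := ltnP m N; last first.
  by apply: le_trans (NP _ Nm) _; rewrite ler_pM2l// ler_nat.
apply: (@le_trans _ _ (C * m%:R)).
  apply: nb_mean_le_linear => //; first exact: log_norm1.
  by move=> a g; apply: le_trans (@log_normM R _ _ G_nontrivial S_gen _ _) _; rewrite lerD2r.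
apply: (@le_trans _ _ (C * N%:R)); first by rewrite ler_pM2l// ler_nat ltnW.
rewrite mulrC -ler_pdivrMl// mulrC; apply: ltW; apply: lt_le_trans (truncnS_gt _) _.
by rewrite ler_nat [eps^-1 * _]mulrC.
Qed.

Lemma amenable_of_slow_norm : polynomial_growth G ->
    (forall eps : R, 0 < eps -> exists N, forall n, (N <= n)%N ->
       @nb_mean R _ T n log_norm <= eps * n%:R) ->
  amenable R (generated [set` T]).
Proof.
move=> /card_aut_norm_le[M [D count]] slow.
apply: amenable_of_slow_decay => // r /andP[r0 r1].
pose l := - ln r; have l0 : 0 < l by rewrite oppr_gt0 ln_lt0// r0.
have D0 : 0 < D.+1%:R :> R by rewrite ltr0n.
(* Chosen so that the D-th power of [expR (2 * (eps * n))] is at most [expR (l * n / 2)], half of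
   the exponent available in r^n = exp(-l n); [D.+1] avoids a division by 0. *)
pose eps := l / (4 * D.+1%:R); have e0 : 0 < eps by rewrite divr_gt0 ?mulr_gt0.
have [N NP] := srw_log_norm e0 slow.
(* The last condition will give [4 * M < expR (l * n / 2)] through 1 + x <= exp x. *)
have [n [/NP Sn n0 big]] :
    exists n, [/\ (N <= n)%N, 0 < n%:R :> R & 4 * M%:R * 2 < l * n%:R].
  exists (maxn N (Num.truncn (4 * M%:R * 2 / l))).+1; split.
  - by rewrite leqW// leq_maxl.
  - by rewrite ltr0n.
  - rewrite -ltr_pdivrMl// mulrC; apply: lt_le_trans (truncnS_gt _) _.
    by rewrite ler_nat ltnS leq_maxr.
exists n.
have en0 : 0 < eps * n%:R by rewrite mulr_gt0.
have [X sX] := @fin_supp_srw R _ T n.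
pose W := [fset f in X | log_norm f <= 2 * (eps * n%:R)]%fset.
pose rho := Num.truncn (expR (2 * (eps * n%:R))).
have rho_ge f : (aut_norm S f <= rho)%N = (log_norm f <= 2 * (eps * n%:R)).
  by rewrite log_norm_le// truncn_ge_nat// ltW// expR_gt0.
have rho0 : (0 < rho)%N.
  apply: leq_trans (aut_norm_gt0 S_gen 1%g G_nontrivial) _; rewrite rho_ge.
  by apply: le_trans (log_norm1 _ _) _ => //; rewrite mulr_ge0// ltW.
have cW : #|` W|%:R <= M%:R * expR (l * n%:R / 2).
  apply: (@le_trans _ _ (M * rho ^ D)%N%:R).
    rewrite ler_nat; apply: count => // f; rewrite !inE => /andP[_].
    by rewrite rho_ge.
  rewrite natrM natrX ler_wpM2l//.
  apply: (@le_trans _ _ (expR (2 * (eps * n%:R)) ^+ D)).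
    by rewrite lerXn2r ?nnegrE ?expR_ge0// -truncn_ge_nat ?expR_ge0.
  rewrite -expRM_natl ler_expR.
  apply: (@le_trans _ _ (D.+1%:R * (2 * (eps * n%:R)))).
    by rewrite ler_wpM2r ?ler_nat// mulr_ge0// ltW.
  by rewrite le_eqVlt; apply/orP; left; apply/eqP; rewrite /eps; field; rewrite gt_eqF.
have s0 := @srw_ge0 R _ T T_gt0 n.
have sumX : \sum_(f <- X) srw R T n f = 1 by rewrite -(fsumE sX) fsum_srw1.
(* Markov's inequality: the mean of [log_norm] is at most [eps * n], so the mass where it exceeds
   twice this is at most 1/2. *)
have half : 1 / 2 <= \sum_(f <- W) srw R T n f.
  have : \sum_(f <- X) srw R T n f <= \sum_(f <- W) srw R T n f + 1 / 2.
    rewrite (bigID (fun f => log_norm f <= 2 * (eps * n%:R)))/=.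
    rewrite big_fset/= lerD2l -(ler_pM2r (_ : 0 < 2 * (eps * n%:R))) ?mulr_gt0//.
    rewrite mulr_suml; apply: (@le_trans _ _ (\sum_(f <- X) srw R T n f * log_norm f)).
      rewrite [leRHS](bigID (fun f => log_norm f <= 2 * (eps * n%:R)))/=.
      apply: ler_wpDl; first by apply: sumr_ge0 => f _; rewrite mulr_ge0 ?log_norm_ge0.
      by apply: ler_sum => f; rewrite -ltNge => /ltW fe; rewrite ler_wpM2l.
    rewrite -fsumE => [|f /sX ->]; last by rewrite mul0r.
    by apply: le_trans Sn _; lra.
  by rewrite sumX; lra.
pose w : R := #|` W|%:R.
have w0 : 0 < w.
  rewrite ltr0n lt0n cardfs_eq0; apply/eqP => W0.
  by move: half; rewrite W0 big_seq_fset0; lra.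
(* Cauchy-Schwarz on [W], in the form s <= w s^2 + 1/(4w) summed over its w elements. *)
have qw : 1 <= 4 * w * srw2 R T n.
  have : \sum_(f <- W) srw R T n f <= w * srw2 R T n + 1 / 4.
    apply: (@le_trans _ _ (\sum_(f <- W) (w * srw R T n f ^+ 2 + w^-1 / 4))).
      apply: ler_sum => f _; rewrite -subr_ge0.
      rewrite (_ : _ - _ = w * (srw R T n f - w^-1 / 2) ^+ 2).
        by rewrite mulr_ge0 ?sqr_ge0// ltW.
      by field; rewrite gt_eqF.
    rewrite big_split/= -mulr_sumr lerD//; last first.
      rewrite big_const_seq count_predT iter_addr_0 -[_ *+ _]mulr_natl -/w.
      by rewrite mulrA mulfV ?mul1r// gt_eqF.
    rewrite ler_pM2l// /srw2 (@fsumE _ _ X) => [|f /sX ->]; last by rewrite expr0n.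
    rewrite [leRHS](bigID (fun f => log_norm f <= 2 * (eps * n%:R)))/= big_fset/=.
    by rewrite lerDl sumr_ge0// => f _; exact: sqr_ge0.
  by lra.
have -> : r ^+ n = expR (- (l * n%:R)).
  by rewrite /l mulNr opprK mulrC expRM_natl lnK// posrE.
have ex : 4 * M%:R < expR (l * n%:R / 2).
  apply: lt_le_trans (expR_ge1Dx _); lra.
have E0 := expR_gt0 (l * n%:R / 2).
have -> : expR (- (l * n%:R)) = (expR (l * n%:R / 2))^-1 ^+ 2.
  by rewrite -expRN -expRM_natl; congr expR; field.
set E := expR _ in cW ex E0 *.
have q0 := @srw2_gt0 R _ T T_gt0 n.
have : 1 <= 4 * (M%:R * E) * srw2 R T n.
  by apply: le_trans qw _; rewrite ler_pM2r// ler_pM2l.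
move=> h; rewrite exprVn -[X in X < _]div1r ltr_pdivrMr ?exprn_gt0//.
apply: le_lt_trans h _; rewrite expr2 mulrC ltr_pM2l//.
by rewrite mulrA ltr_pM2r.
Qed.

End Growth.

(** * Subadditive processes over an ergodic transformation *)

Section BoundedMean.
Context {R : realType} {d : measure_display} {U : measurableType d}.
Variable mu : probability U R.
Implicit Types f h : U -> R.

(** A class closed under the operations below and contained in L1 of every probability measure, so
    that [mean] is linear on it. *)
Definition bdd_mfun f := measurable_fun setT f /\ exists C, forall x, `|f x| <= C.

Definition mean f : R := \int[mu]_x f x.

Lemma bdd_mfun_integrable f : bdd_mfun f -> mu.-integrable setT (EFin \o f).
Proof.
move=> [mf [C fC]]; apply: measurable_bounded_integrable => //.
  by apply: le_lt_trans (probability_le1 mu measurableT) _; rewrite ltry.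
by exists C; split; rewrite ?num_real// => M CM x _; apply: le_trans (fC x) (ltW CM).
Qed.

Lemma bdd_mfun_cst c : bdd_mfun (fun=> c).
Proof. by split => //; exists `|c|. Qed.

Lemma bdd_mfunD f h : bdd_mfun f -> bdd_mfun h -> bdd_mfun (fun x => f x + h x).
Proof.
move=> [mf [C fC]] [mh [D hD]]; split; first exact: measurable_funD.
by exists (C + D) => x; apply: le_trans (ler_normD _ _) (lerD _ _).
Qed.

Lemma bdd_mfunZ c f : bdd_mfun f -> bdd_mfun (fun x => c * f x).
Proof.
move=> [mf [C fC]]; split; first exact: measurable_funM.
by exists (`|c| * C) => x; rewrite normrM ler_wpM2l.
Qed.

Lemma bdd_mfun_indic A : measurable A -> bdd_mfun \1_A.
Proof.
move=> mA; split; first exact: measurable_indic.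
by exists 1 => x; rewrite indicE normr_nat lern1 leq_b1.
Qed.

Lemma bdd_mfun_sum (J : Type) (r : seq J) (F : J -> U -> R) :
  (forall i, bdd_mfun (F i)) -> bdd_mfun (fun x => \sum_(i <- r) F i x).
Proof.
move=> bF; elim: r => [|i r IH].
  by under eq_fun do rewrite big_nil; exact: bdd_mfun_cst.
by under eq_fun do rewrite big_cons; exact: bdd_mfunD.
Qed.

Lemma bdd_mfunM f h : bdd_mfun f -> bdd_mfun h -> bdd_mfun (fun x => f x * h x).
Proof.
move=> [mf [C fC]] [mh [D hD]]; split; first exact: measurable_funM.
by exists (C * D) => x; rewrite normrM ler_pM.
Qed.

Lemma meanD f h : bdd_mfun f -> bdd_mfun h ->
  mean (fun x => f x + h x) = mean f + mean h.
Proof. by move=> bf bh; rewrite /mean RintegralD//; exact: bdd_mfun_integrable. Qed.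

Lemma meanZ c f : bdd_mfun f -> mean (fun x => c * f x) = c * mean f.
Proof. by move=> bf; rewrite /mean RintegralZl//; exact: bdd_mfun_integrable. Qed.

Lemma mean_cst c : mean (fun=> c) = c.
Proof.
rewrite /mean Rintegral_cst//; transitivity (c * fine 1%E); last by rewrite mulr1.
by congr (_ * fine _); exact: probability_setT.
Qed.

Lemma mean_le f h : bdd_mfun f -> bdd_mfun h -> (forall x, f x <= h x) ->
  mean f <= mean h.
Proof. by move=> bf bh fh; apply: le_Rintegral => //; exact: bdd_mfun_integrable. Qed.

Lemma mean_indic A : measurable A -> mean \1_A = fine (mu A).
Proof. by move=> mA; rewrite /mean /Rintegral integral_indic// setIT. Qed.

Lemma mean_sum (J : Type) (r : seq J) (F : J -> U -> R) :
  (forall i, bdd_mfun (F i)) ->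
  mean (fun x => \sum_(i <- r) F i x) = \sum_(i <- r) mean (F i).
Proof.
move=> bF; elim: r => [|i r IH].
  by under eq_fun do rewrite big_nil; rewrite big_nil mean_cst.
under eq_fun do rewrite big_cons; rewrite big_cons -IH meanD//.
exact: bdd_mfun_sum.
Qed.

Lemma measurable_le_cst f c : measurable_fun setT f -> measurable [set x | f x <= c].
Proof.
move=> mf; have := mf measurableT _ (measurable_itv `]-oo, c]); rewrite setTI.
by rewrite (_ : _ @^-1` _ = [set x | f x <= c])//; apply/seteqP; split => x /=;
  rewrite in_itv.
Qed.

Lemma measurable_gt_cst f c : measurable_fun setT f -> measurable [set x | c < f x].
Proof.
move=> /(measurable_le_cst c)/measurableC; congr measurable.
by apply/seteqP; split => x /=; rewrite ltNge => /negP.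
Qed.

End BoundedMean.

Section Ergodic.
Context {R : realType} {d : measure_display} {U : measurableType d}.
Variables (mu : probability U R) (shift : U -> U).
Hypothesis m_shift : measurable_fun setT shift.
Hypothesis mu_shift : forall A, measurable A -> mu (shift @^-1` A) = mu A.
Hypothesis ergodic :
  forall A, measurable A -> shift @^-1` A = A -> mu A = 0%E \/ mu A = 1%E.

Lemma iterSl n x : iter n shift (shift x) = shift (iter n shift x).
Proof. by rewrite -iterS iterSr. Qed.

Lemma measurable_iter_shift n : measurable_fun setT (iter n shift).
Proof.
elim: n => [|n IH]; first exact: measurable_id.
exact: (measurableT_comp m_shift IH).
Qed.

Lemma bdd_mfun_iter n (f : U -> R) : bdd_mfun f -> bdd_mfun (fun x => f (iter n shift x)).
Proof.
move=> [mf [C fC]]; split; last by exists C.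
exact: (measurableT_comp mf (measurable_iter_shift n)).
Qed.

Lemma mean_shift (f : U -> R) : bdd_mfun f -> mean mu (fun x => f (shift x)) = mean mu f.
Proof.
move=> bf; rewrite /mean /Rintegral; congr fine.
have bfs : bdd_mfun (fun x => f (shift x)) := bdd_mfun_iter 1 bf.
transitivity (\int[pushforward mu shift]_x (f x)%:E)%E.
  rewrite integral_pushforward//=.
  - by case: bf => mf _; exact/measurable_EFinP.
  - exact: (bdd_mfun_integrable mu bfs).
by apply: eq_measure_integral => A mA _; exact: mu_shift.
Qed.

Lemma mean_iter_shift n (f : U -> R) : bdd_mfun f ->
  mean mu (fun x => f (iter n shift x)) = mean mu f.
Proof.
elim: n f => [|n IH] f bf //.
rewrite -[RHS]IH// -[RHS]mean_shift; last exact: bdd_mfun_iter.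
by congr mean; apply/funext => x; rewrite iterSl.
Qed.

(** * The almost sure lower bound for subadditive processes *)

Section LowerBound.
Variables (Y : nat -> U -> R) (C nu : R).
Hypothesis mY : forall n, measurable_fun setT (Y n).
Hypothesis subY : forall m n x, Y (m + n) x <= Y m x + Y n (iter m shift x).
Hypothesis YC : forall n x, `|Y n x| <= C * n%:R.
Hypothesis Y_shift : forall n x, `|Y n (shift x) - Y n x| <= C.
Hypothesis nuY : forall (e : R) N, 0 < e ->
  exists2 n, (N <= n)%N & (nu - e) * n%:R <= mean mu (Y n).

Let C_ge0 : 0 <= C.
Proof. exact: le_trans (normr_ge0 _) (Y_shift 0 point). Qed.

Let bad (c : R) (N : nat) : set U :=
  [set x | forall n, (0 < n <= N)%N -> c * n%:R < Y n x].

(* Cut [0, M) into blocks of length at most N on which Y is at most c times the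
   length, single steps starting in the bad set, and a rest shorter than N. *)
Let covering (c : R) (N M : nat) x :
  Y M x <= c * M%:R
    + (C + `|c|) * (\sum_(i < M) \1_(bad c N) (iter i shift x) + N%:R).
Proof.
set B := bad c N; set K := C + `|c|.
have K0 : 0 <= K by rewrite addr_ge0.
have cK : `|c| <= K by rewrite lerDr.
have S0 n y : 0 <= \sum_(i < n) \1_B (iter i shift y) :> R.
  by apply: sumr_ge0 => i _; rewrite indicE.
elim/ltn_ind: M x => M IH x.
have [MN|NM] := leqP M N.
  have : Y M x <= C * M%:R by apply: le_trans (ler_norm _) _.
  have : - (c * M%:R) <= `|c| * M%:R by rewrite -mulNr ler_wpM2r// ler_normr lexx orbT.
  have : K * M%:R <= K * N%:R by rewrite ler_wpM2l// ler_nat.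
  have : 0 <= K * \sum_(i < M) \1_B (iter i shift x) by rewrite mulr_ge0.
  by rewrite /K; lra.
have step m : (0 < m <= M)%N -> Y M x <= Y m x + (c * (M - m)%:R
    + K * (\sum_(i < M - m) \1_B (iter i shift (iter m shift x)) + N%:R)).
  move=> /andP[m0 mM]; rewrite -[in Y M x](subnKC mM).
  by apply: le_trans (subY _ _ _) _; rewrite lerD2l; apply: IH; lia.
have split_sum m : (m <= M)%N -> \sum_(i < M) \1_B (iter i shift x) =
    \sum_(i < m) \1_B (iter i shift x)
    + \sum_(i < M - m) \1_B (iter i shift (iter m shift x)) :> R.
  move=> mM; rewrite -[in LHS](subnKC mM) big_split_ord; congr (_ + _).
  by apply: eq_bigr => i _; rewrite /= addnC iterD.
have [xB|xB] := pselect (B x).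
  apply: le_trans (step 1%N _) _; first by rewrite (leq_ltn_trans _ NM).
  rewrite (split_sum 1%N) ?(leq_ltn_trans _ NM)// big_ord1 /= indicE mem_set//.
  have : Y 1%N x <= C by apply: le_trans (ler_norm _) _; rewrite -[leRHS]mulr1.
  have M1 : (M - 1)%:R = M%:R - 1 :> R by rewrite natrB// (leq_ltn_trans _ NM).
  have : - c <= `|c| by rewrite ler_normr lexx orbT.
  by rewrite M1 mulr1n /K; set s := \sum_(_ < _) _; lra.
have /existsNP[n /not_implyP[/andP[n0 nN] /negP]] := xB.
rewrite -leNgt => Yn; have nM : (n <= M)%N by lia.
apply: le_trans (step n _) _; first by rewrite n0.
rewrite (split_sum n)// natrB//.
have : 0 <= K * \sum_(i < n) \1_B (iter i shift x) by rewrite mulr_ge0.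
by set s := \sum_(_ < n) _; set s' := \sum_(_ < _ - _) _; lra.
Qed.

Let low (c : R) : set U :=
  \bigcup_K \bigcap_N \bigcup_(n in [set n | (N <= n)%N])
    [set x | Y n x <= c * n%:R + K%:R].

Let low_measurable c : measurable (low c).
Proof.
apply: bigcupT_measurable => K; apply: bigcapT_measurable => N.
by apply: bigcup_measurable => n _; exact: measurable_le_cst.
Qed.

Let low_shift c : shift @^-1` low c = low c.
Proof.
pose k := (Num.truncn C).+1; have Ck : C <= k%:R by rewrite ltW// truncnS_gt.
apply/seteqP; split => x [K _ xK]; exists (K + k)%N => // N _;
    have [n /= Nn Yn] := xK N I; exists n => //=; rewrite natrD;
    have := Y_shift n x; rewrite ler_norml => /andP[]; lra.
Qed.

(** If [low c] had full measure, almost every point would have a block of mean at most the midpoint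
    [c2], and the bad sets would shrink to a null set. Integrating [covering] would then keep the
    means of [Y M] below [(nu - e) * M] for large M. *)
Let low_null c : c < nu -> mu (low c) = 0%E.
Proof.
move=> cnu; case: (ergodic (low_measurable c) (low_shift c)) => // low1.
exfalso.
(* Here [c2 = nu - 4 * e], while the bad set, the rest of the covering and [nuY] cost at most [e]
   each. *)
pose c2 := (c + nu) / 2; pose e := (nu - c) / 8.
have e0 : 0 < e by rewrite divr_gt0// subr_gt0.
pose B N := bad c2 N.
have mB N : measurable (B N).
  rewrite (_ : B N = \bigcap_(n in [set n | (0 < n <= N)%N]) [set x | c2 * n%:R < Y n x]).
    by apply: bigcap_measurableType => n _; exact: measurable_gt_cst.
  by apply/seteqP; split=> x Bx n; exact: Bx.
(* On [low c] the bound c n + K drops below c2 n once n > K/(c2 - c), so no point of it is bad for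
   every [N]. *)
have Bcap : mu (\bigcap_N B N) = 0%E.
  apply/eqP; rewrite eq_le measure_ge0 andbT.
  have <- : mu (~` low c) = 0%E by rewrite probability_setC// low1 subee.
  apply: le_measure; rewrite ?inE; [exact: bigcapT_measurable|exact: measurableC|].
  move=> x xB [K _ /(_ (Num.truncn (K%:R / (c2 - c))).+1 I)[n /= Nn Yn]].
  have : c2 * n%:R < Y n x by apply: (xB n I); rewrite leqnn andbT; lia.
  apply/negP; rewrite -leNgt; apply: le_trans Yn _.
  have c2c : 0 < c2 - c by rewrite /c2; lra.
  rewrite -lerBrDl -mulrBl mulrC -ler_pdivrMr//; apply: ltW.
  by apply: lt_le_trans (truncnS_gt _) _; rewrite ler_nat.
pose K := C + `|c2|; have K0 : 0 <= K by rewrite addr_ge0.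
have [N BN] : exists N, K * fine (mu (B N)) <= e.
  have : mu (B N) @[N --> \oo] --> mu (\bigcap_N B N).
    apply: nonincreasing_cvg_mu => //; last 2 first.
    - exact: bigcapT_measurable.
    - move=> m n mn; apply/subsetPset => x xB i /andP[i0 im].
      by apply: xB; rewrite i0 (leq_trans im).
    by apply: le_lt_trans (probability_le1 mu (mB 0%N)) _; rewrite ltry.
  rewrite Bcap => /fine_cvg /cvgrPdist_le/(_ (e / (K + 1))) [].
    by rewrite divr_gt0// ltr_wpDl.
  move=> N _ /(_ N (leqnn N)) /=; rewrite sub0r normrN => BN; exists N.
  have : `|fine (mu (B N))| * (K + 1) <= e by rewrite -ler_pdivlMr// ltr_wpDl.
  by rewrite ger0_norm ?fine_ge0//; have := fine_ge0 (measure_ge0 mu (B N)); nra.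
have bY n : bdd_mfun (Y n) by split => //; exists (C * n%:R).
have bI i : bdd_mfun (fun x => \1_(B N) (iter i shift x) : R).
  exact: (bdd_mfun_iter i (bdd_mfun_indic (mB N))).
have EY M : mean mu (Y M) <= c2 * M%:R + K * (M%:R * fine (mu (B N)) + N%:R).
  have bS : bdd_mfun (fun x => \sum_(i < M) \1_(B N) (iter i shift x) + N%:R : R).
    apply: bdd_mfunD; last exact: bdd_mfun_cst.
    by apply: bdd_mfun_sum => i; exact: bI.
  apply: (@le_trans _ _ (mean mu (fun x => c2 * M%:R
      + K * (\sum_(i < M) \1_(B N) (iter i shift x) + N%:R)))).
    apply: mean_le; [by [] | | by move=> x; exact: covering].
    by apply: bdd_mfunD; [exact: bdd_mfun_cst | exact: bdd_mfunZ].
  rewrite meanD; [|exact: bdd_mfun_cst|exact: bdd_mfunZ].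
  rewrite mean_cst meanZ// meanD; [|by apply: bdd_mfun_sum => i; exact: bI|exact: bdd_mfun_cst].
  rewrite mean_cst mean_sum => [|i]; last exact: bI.
  rewrite lerD2l ler_wpM2l// lerD2r.
  under eq_bigr => i _ do rewrite (mean_iter_shift i (bdd_mfun_indic (mB N))) mean_indic//.
  by rewrite sumr_const card_ord -[_ *+ _]mulr_natl.
have [M NM YM] := nuY (Num.truncn (K * N%:R / e)).+1 e0.
have M0 : 0 <= M%:R :> R by [].
have : K * N%:R < e * M%:R.
  rewrite -ltr_pdivrMl// [e^-1 * _]mulrC; apply: lt_le_trans (truncnS_gt _) _.
  by rewrite ler_nat.
have := EY M; have : K * (M%:R * fine (mu (B N))) <= e * M%:R.
  by rewrite mulrCA mulrC ler_wpM2r.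
have : 0 < e * M%:R.
  by rewrite mulr_gt0// ltr0n; lia.
move: YM; rewrite /c2 /e mulrDr; set b := K * (_ * _); set b' := K * _; lra.
Qed.

(** The exceptional set must not depend on [c], so the countably many levels [nu - k.+1%:R^-1] are
    used. *)
Lemma subadditive_liminf :
  {ae mu, forall x c, c < nu -> exists N, forall n, (N <= n)%N -> c * n%:R < Y n x}.
Proof.
have : {ae mu, forall x k, ~ low (nu - k.+1%:R^-1) x}.
  apply/ae_foralln => k; exists (low (nu - k.+1%:R^-1)); split => //.
    by apply: low_null; rewrite ltrBlDr ltrDl invr_gt0.
  by move=> x /= /contrapT.
apply: filterS => x xlow c cnu.
pose k := Num.truncn ((nu - c)^-1).
have ck : c < nu - k.+1%:R^-1.
  rewrite ltrBrDr addrC -ltrBrDr invf_plt ?posrE ?subr_gt0//.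
  exact: truncnS_gt.
(* Failure at [c] gives infinitely many n with [Y n x <= c * n], which puts x in a [low] set with K
   = 0. *)
apply: contrapT => /forallNP H; apply: (xlow k); exists 0%N => // N _.
have /existsNP[n /not_implyP[Nn /negP]] := H N; rewrite -leNgt => Yn.
by exists n => //=; rewrite addr0; apply: le_trans Yn _; rewrite ler_wpM2r// ltW.
Qed.

End LowerBound.

End Ergodic.

Section Subadditive.
Context {R : realType} {d : measure_display} {U : measurableType d}.
Variables (mu : probability U R) (shift : U -> U).
Hypothesis m_shift : measurable_fun setT shift.
Hypothesis mu_shift : forall A, measurable A -> mu (shift @^-1` A) = mu A.
Hypothesis ergodic :
  forall A, measurable A -> shift @^-1` A = A -> mu A = 0%E \/ mu A = 1%E.

(** The negated Birkhoff sums are additive with mean exactly [- mean mu f * n], so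
    [subadditive_liminf] applies to them. *)
Lemma birkhoff_limsup (f : U -> R) (c : R) : bdd_mfun f -> mean mu f < c ->
  {ae mu, forall x, exists N, forall n, (N <= n)%N ->
     \sum_(i < n) f (iter i shift x) < c * n%:R}.
Proof.
move=> bf fc; have [_ [C fC]] := bf.
have C0 : 0 <= C by apply: le_trans (fC point).
have bfi i : bdd_mfun (fun x => f (iter i shift x)) by exact: bdd_mfun_iter.
have bS n : bdd_mfun (fun x => \sum_(i < n) f (iter i shift x)).
  by apply: bdd_mfun_sum => i; exact: bfi.
have bY n : bdd_mfun (fun x => - \sum_(i < n) f (iter i shift x)).
  by have := bdd_mfunZ (-1) (bS n); under eq_fun do rewrite mulN1r.
have EY n : mean mu (fun x => - \sum_(i < n) f (iter i shift x)) = - mean mu f * n%:R.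
  under eq_fun do rewrite -mulN1r.
  rewrite meanZ// mean_sum => [|i]; last exact: bfi.
  under eq_bigr do rewrite mean_iter_shift//.
  by rewrite sumr_const card_ord -[_ *+ _]mulr_natl; ring.
have := @subadditive_liminf R d U mu shift m_shift mu_shift ergodic
  (fun n x => - \sum_(i < n) f (iter i shift x)) (C + C) (- mean mu f).
(* Telescoping: shifting the start changes a Birkhoff sum by two values of [f] only, hence the
   constant [C + C]. *)
have SS n x : \sum_(i < n) f (iter i shift (shift x)) + f x =
    \sum_(i < n) f (iter i shift x) + f (iter n shift x).
  transitivity (\sum_(i < n.+1) f (iter i shift x)); last by rewrite big_ord_recr.
  by rewrite big_ord_recl addrC; congr (_ + _); apply: eq_bigr => i _; rewrite iterSl.
move=> /(_ (fun n => (bY n).1)) [].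
- move=> m n x; rewrite big_split_ord opprD lerD2l lerN2.
  by rewrite le_eqVlt; apply/orP; left; apply/eqP; apply: eq_bigr => i _;
    rewrite /= addnC iterD.
- move=> n x; rewrite normrN; apply: le_trans (ler_norm_sum _ _ _) _.
  apply: (@le_trans _ _ (\sum_(i < n) C)); first by apply: ler_sum => i _; exact: fC.
  by rewrite sumr_const card_ord -[_ *+ _]mulr_natl mulrC ler_wpM2r// lerDl.
- move=> n x; rewrite opprK addrC.
  have -> : \sum_(i < n) f (iter i shift x) - \sum_(i < n) f (iter i shift (shift x))
      = f x - f (iter n shift x) by have := SS n x; lra.
  by apply: le_trans (ler_normB _ _) (lerD _ _); exact: fC.
- move=> e N e0; exists N => //; rewrite EY ler_wpM2r// lerBlDr lerDl ltW//.
- move=> N [mN N0 sN]; exists N; split => // x /= xH; apply: sN => /= H; apply: xH.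
  have /H[n0 xn] : - c < - mean mu f by rewrite ltrN2.
  by exists n0 => n /xn; rewrite mulNr ltrN2.
Qed.

(** * Convergence of nonnegative subadditive processes *)

Variables (X : nat -> U -> R) (C nu : R).
Hypothesis mX : forall n, measurable_fun setT (X n).
Hypothesis X_ge0 : forall n x, 0 <= X n x.
Hypothesis X_le : forall n x, X n x <= C * n%:R.
Hypothesis subX : forall m n x, X (m + n) x <= X m x + X n (iter m shift x).
Hypothesis X_shift : forall n x, `|X n (shift x) - X n x| <= C.
Hypothesis nu_ge : forall e : R, 0 < e -> exists N, forall n, (N <= n)%N ->
  mean mu (X n) <= (nu + e) * n%:R.
Hypothesis nu_le : forall (e : R) N, 0 < e ->
  exists2 n, (N <= n)%N & (nu - e) * n%:R <= mean mu (X n).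

Let C_ge0 : 0 <= C.
Proof. exact: le_trans (normr_ge0 _) (X_shift 0 point). Qed.

Let X_shift_iter n r x : `|X n (iter r shift x) - X n x| <= C * r%:R.
Proof.
elim: r => [|r IH]; first by rewrite subrr normr0 mulr0.
have := X_shift n (iter r shift x); move: IH; rewrite -natr1 mulrDr mulr1 /=.
by rewrite !ler_norml => /andP[? ?] /andP[? ?]; apply/andP; split; lra.
Qed.

(* Cutting X_n into blocks of length m in the m possible ways. *)
Let block_sum m n x : (0 < m)%N ->
  \sum_(r < m) X n (iter r shift x) <=
  \sum_(i < n) X m (iter i shift x) + C * m%:R * m%:R.
Proof.
move=> m0; elim/ltn_ind: n x => n IH x.
have [nm|mn] := ltnP n m.
  apply: (@le_trans _ _ (\sum_(r < m) C * m%:R)).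
    apply: ler_sum => r _; apply: le_trans (X_le _ _) _.
    by rewrite ler_wpM2l// ler_nat ltnW.
  by rewrite sumr_const card_ord -[_ *+ _]mulr_natr lerDr sumr_ge0.
have := IH (n - m)%N _ (iter m shift x); rewrite ltn_subrL m0 (leq_trans m0 mn).
move=> /(_ isT) IHn.
rewrite -[in X in _ <= X + _](subnKC mn) big_split_ord /= -addrA.
have -> : \sum_(i < n - m) X m (iter (m + i) shift x) =
    \sum_(i < n - m) X m (iter i shift (iter m shift x)).
  by apply: eq_bigr => i _; rewrite addnC iterD.
apply: le_trans (lerD (lexx _) IHn).
rewrite -big_split; apply: ler_sum => r _; rewrite -[in X in X <= _](subnKC mn).
by apply: le_trans (subX _ _ _) _; rewrite lerD2l -!iterD addnC.
Qed.

(** The lower bound is [subadditive_liminf]. For the upper one, [block_sum] compares m X_n with the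
    Birkhoff sum of X_m for a fixed m whose mean is nearly m nu. *)
Lemma subadditive_cvg : {ae mu, forall x, X n x / n%:R @[n --> \oo] --> nu}.
Proof.
have bX n : bdd_mfun (X n).
  by split => //; exists (C * n%:R) => x; rewrite ger0_norm.
have Hlo : {ae mu, forall x c, c < nu ->
    exists N, forall n, (N <= n)%N -> c * n%:R < X n x}.
  apply: (@subadditive_liminf _ _ _ mu shift m_shift mu_shift ergodic X C) => //.
  by move=> n x; rewrite ger0_norm.
have Hhi : {ae mu, forall x k, exists K N, forall n, (N <= n)%N ->
    X n x <= (nu + k.+1%:R^-1) * n%:R + K}.
  (* Half of the margin goes into the choice of m, which leaves the strict inequality that
     [birkhoff_limsup] asks for; [m0.+1] makes m positive. *)
  apply/ae_foralln => k; have k0 : 0 < k.+1%:R^-1 / 2 :> R by rewrite divr_gt0.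
  have [m0 /(_ m0.+1 (leqnSn _)) Xm] := nu_ge k0; set m := m0.+1 in Xm.
  have m_gt0 : 0 < m%:R :> R by rewrite ltr0n.
  have : mean mu (X m) < (nu + k.+1%:R^-1) * m%:R.
    by apply: le_lt_trans Xm _; rewrite ltr_pM2r// ltrD2l ltr_pdivrMr// ltr_pMr ?invr_gt0// ltr1n.
  move=> /(birkhoff_limsup (bX m)); apply: filterS => x [N xN].
  (* One term pays for replacing [X n x] by its values at the first m shifts, the other is the rest
     in [block_sum] divided by m. *)
  exists (C * m%:R + C * m%:R), N => n /xN Sn.
  rewrite -(ler_pM2r m_gt0).
  apply: (@le_trans _ _ (\sum_(r < m) (X n (iter r shift x) + C * m%:R))).
    have -> : X n x * m%:R = \sum_(r < m) X n x by rewrite sumr_const card_ord mulr_natr.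
    apply: ler_sum => r _.
    have := X_shift_iter n r x; rewrite ler_norml => /andP[+ _].
    have : C * r%:R <= C * m%:R by rewrite ler_wpM2l// ler_nat ltnW.
    lra.
  rewrite big_split/= sumr_const card_ord -[_ *+ _]mulr_natr.
  have := block_sum n x (ltn0Sn m0); rewrite -/m; move: Sn.
  by move: (k.+1%:R^-1) (m%:R : R) => ik mm; lra.
move: Hlo Hhi; apply: filterS2 => x xlo xhi.
apply/cvgrPdist_le => e e0.
have [N1 H1] := xlo (nu - e) (ltac:(lra)).
pose k := Num.truncn (2 / e).
have ke : k.+1%:R^-1 <= e / 2.
  by rewrite -[e / 2]invrK lef_pV2 ?posrE ?invr_gt0 ?divr_gt0// invf_div ltW// truncnS_gt.
have [K [N2 H2]] := xhi k.
exists (maxn (maxn N1 N2) (Num.truncn (2 * K / e))).+1 => // n /=.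
rewrite !gtn_max => /andP[/andP[nN1 nN2] nN].
have n0 : 0 < n%:R :> R by rewrite ltr0n (leq_ltn_trans _ nN1).
have Kn : K < e / 2 * n%:R.
  rewrite mulrAC ltr_pdivlMr// -ltr_pdivrMl// [e^-1 * _]mulrC [K * 2]mulrC.
  by apply: lt_le_trans (truncnS_gt _) _; rewrite ler_nat.
rewrite -(ler_pM2r n0) -{2}(gtr0_norm n0) -normrM mulrBl divfK ?gt_eqF//.
rewrite ler_norml; apply/andP; split.
  have := H2 n (ltnW nN2).
  have : k.+1%:R^-1 * n%:R <= e / 2 * n%:R by rewrite ler_wpM2r.
  by move: (k.+1%:R^-1) => ik; lra.
by have := H1 n (ltnW nN1); lra.
Qed.

End Subadditive.

(** * Infinite words *)

(** The letter [a0] provides the base point of the type and the padding of finite words in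
    [word_path]. *)
Definition infword_raw (X : finType) (a0 : letter X) : Type := nat -> letter X.

HB.instance Definition _ X a0 := gen_eqMixin (@infword_raw X a0).
HB.instance Definition _ X a0 := gen_choiceMixin (@infword_raw X a0).
HB.instance Definition _ X a0 := isPointed.Build (@infword_raw X a0) (fun=> a0).

Section PathSpace.
Variables (X : finType) (a0 : letter X).

Definition cylinder (n : nat) (u : nat -> letter X) : set (infword_raw a0) :=
  [set x | forall i, (i < n)%N -> x i = u i].

(** The empty set makes the family closed under intersection, as uniqueness of measures requires. *)
Definition cylinders : set (set (infword_raw a0)) :=
  [set A | A = set0 \/ exists n u, A = cylinder n u].

Definition infword := g_sigma_algebraType cylinders.

Definition infshift (x : infword) : infword := fun n => x n.+1.

Lemma iter_shiftE n (x : infword) i : iter n infshift x i = x (n + i)%N.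
Proof. by elim: n i => [|n IH] i //=; rewrite /infshift IH addnS. Qed.

Lemma cylinder_measurable n u : measurable (cylinder n u : set infword).
Proof. by apply: sub_sigma_algebra; right; exists n, u. Qed.

Lemma cylinder0 u : cylinder 0 u = setT.
Proof. by apply/seteqP; split. Qed.

Lemma cylinders_setI : setI_closed cylinders.
Proof.
move=> A B [->|[m [u ->]]]; first by rewrite set0I; left.
move=> [->|[n [v ->]]]; first by rewrite setI0; left.
wlog mn : m n u v / (m <= n)%N => [H|].
  have [/H|/ltnW/H] := leqP m n; first exact.
  by rewrite setIC; apply.
have [uv|uv] := pselect (forall i, (i < m)%N -> u i = v i); [right|left].
  exists n, v; apply/seteqP; split=> [x []//|x xv]; split=> // i im.
  by rewrite uv// xv// (leq_trans im).
rewrite -subset0 => x [xu xv]; apply: uv => i im.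
by rewrite -xu// xv// (leq_trans im).
Qed.

Lemma infword_measure_unique (R : realType) (m1 m2 : {measure set infword -> \bar R}) :
  (m1 setT < +oo)%E -> (forall n u, m1 (cylinder n u) = m2 (cylinder n u)) ->
  forall A, measurable A -> m1 A = m2 A.
Proof.
move=> fin m12 A mA.
have := @measure_unique _ R infword cylinders (fun=> setT) _ _ _ _ m1 m2 _ _ A mA; apply => //.
- exact: cylinders_setI.
- by move=> i; right; exists 0%N, (fun=> a0); rewrite cylinder0.
- by rewrite bigcup_const//; exists 0%N.
- by move=> B [->|[n [u ->]]]; rewrite ?measure0.
Qed.

Lemma shift_cylinder n u :
  infshift @^-1` cylinder n u = [set x | forall i, (i < n)%N -> x i.+1 = u i].
Proof. by []. Qed.

Definition word_path n (w : n.-tuple (letter X)) : infword := fun i => nth a0 w i.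

Lemma word_pathK n (x : infword) i : (i < n)%N -> word_path [tuple x i | i < n] i = x i.
Proof.
by move=> ni; rewrite /word_path -[i]/(nat_of_ord (Ordinal ni)) -tnth_nth tnth_mktuple.
Qed.

Definition prefix_fun n (Z : Type) (f : infword -> Z) :=
  forall x y : infword, (forall i, (i < n)%N -> x i = y i) -> f x = f y.

(** There are finitely many prefixes of length n, so the preimage of any [B] is a finite union of
    cylinders. *)
Lemma prefix_preimage_measurable n (Z : Type) (f : infword -> Z) (B : set Z) :
  prefix_fun n f -> measurable (f @^-1` B).
Proof.
move=> fn; have -> : f @^-1` B = \bigcup_(w in [set w : n.-tuple (letter X) |
    B (f (word_path w))]) cylinder n (word_path w).
  apply/seteqP; split=> [x Bx|x [w /= Bw xw]].
    exists [tuple x i | i < n]; last by move=> i ni; rewrite word_pathK.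
    by rewrite /= (fn _ x)// => i ni; rewrite word_pathK.
  by rewrite /= (fn _ _ xw).
by apply: fin_bigcup_measurable => // w _; exact: cylinder_measurable.
Qed.

Lemma prefix_bdd_mfun (R : realType) n (f : infword -> R) :
  prefix_fun n f -> bdd_mfun f.
Proof.
move=> fn; split.
  by move=> _ B mB; rewrite setTI; exact: prefix_preimage_measurable fn.
exists (\sum_(w : n.-tuple (letter X)) `|f (word_path w)|) => x.
rewrite (fn x (word_path [tuple x i | i < n])); last first.
  by move=> i ni; rewrite word_pathK.
by rewrite (bigD1 [tuple x i | i < n])//= lerDl sumr_ge0.
Qed.

Lemma measurable_shift : measurable_fun setT infshift.
Proof.
have H := @measurability _ _ infword infword setT infshift cylinders erefl; apply: H => _ [B [->|[n [u ->]]] <-].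
  by rewrite preimage_set0 setI0.
rewrite setTI shift_cylinder.
rewrite (_ : [set x | _] = (fun x : infword => [tuple x i.+1 | i < n]) @^-1`
    [set w | forall i, (i < n)%N -> nth a0 w i = u i]).
  apply: (@prefix_preimage_measurable n.+1) => x y xy.
  by apply: eq_mktuple => i; rewrite xy// ltnS.
have nthE (x : infword) i : (i < n)%N -> nth a0 [tuple x i.+1 | i < n] i = x i.+1.
  by move=> ni; rewrite -[i]/(nat_of_ord (Ordinal ni)) -tnth_nth tnth_mktuple.
by apply/seteqP; split => x /= xu i ni; [rewrite nthE ?xu|rewrite -xu ?nthE].
Qed.

End PathSpace.

(** * The non-backtracking measure: stationarity, Markov property and ergodicity *)

Section PathMeasure.
Variables (R : realType) (X : finType) (a0 : letter X).
Hypothesis X_gt1 : (1 < #|X|)%N.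
Local Notation infword := (infword a0).
Local Notation infshift := (@infshift X a0).
Variable mu : probability infword R.

Let q : R := (2 * #|X| - 1)%N%:R.
Let card : R := (2 * #|X|)%N%:R.

Let q_gt0 : 0 < q.
Proof. by rewrite ltr0n; lia. Qed.

Let card_q : card = q + 1.
Proof. by rewrite /card /q natr1; congr _%:R; lia. Qed.

Definition nb_step (a b : letter X) : R :=
  if b == letter_inv a then 0 else q^-1.

(** The probability of the prefix u 0, ..., u n: its n + 1 letters make n transitions. *)
Definition nb_weight (n : nat) (u : nat -> letter X) : R :=
  card^-1 * \prod_(i < n) nb_step (u i) (u i.+1).

Hypothesis mu_cylinder : forall n u, mu (@cylinder X a0 n.+1 u) = (nb_weight n u)%:E.

Lemma nb_step_ge0 a b : 0 <= nb_step a b.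
Proof. by rewrite /nb_step; case: ifP => // _; rewrite invr_ge0 ltW. Qed.

Lemma nb_weight_ge0 n u : 0 <= nb_weight n u.
Proof. by rewrite mulr_ge0 ?invr_ge0// prodr_ge0// => i _; exact: nb_step_ge0. Qed.

Lemma sum_nb_step a F : \sum_b nb_step a b * F b =
  q^-1 * (\sum_b F b - F (letter_inv a)).
Proof.
rewrite [\sum_b F b](bigD1 (letter_inv a))//= addrC addrK mulr_sumr.
rewrite (bigD1 (letter_inv a))//= {1}/nb_step eqxx mul0r add0r.
by apply: eq_bigr => b ba; rewrite /nb_step (negPf ba).
Qed.

(** Formal inversion shows that columns of the transition matrix sum like rows, so the uniform law
    on letters is stationary. *)
Lemma sum_nb_stepl b : \sum_a nb_step a b = 1.
Proof.
transitivity (\sum_a nb_step b a * 1).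
  rewrite (reindex_inj (inv_inj (@letter_invK X))) [RHS](reindex_inj (inv_inj (@letter_invK X)))/=.
  apply: eq_bigr => a _; rewrite mulr1 /nb_step (@letter_invK X).
  by rewrite (inj_eq (inv_inj (@letter_invK X))) eq_sym.
rewrite sum_nb_step sumr_const card_letter -/card card_q addrK mulVf//.
by rewrite gt_eqF.
Qed.

Implicit Types A B : set infword.

Definition pr A : R := fine (mu A).

Lemma prE A : measurable A -> mu A = (pr A)%:E.
Proof. by move=> mA; rewrite fineK// fin_num_measure. Qed.

Lemma pr_cylinder n u : pr (@cylinder X a0 n.+1 u) = nb_weight n u.
Proof. by rewrite /pr mu_cylinder. Qed.

Definition letter_at (m : nat) (b : letter X) : set infword := [set x | x m = b].

Lemma letter_at_measurable m b : measurable (letter_at m b).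
Proof.
apply: (@prefix_preimage_measurable X a0 m.+1 _ (fun x : infword => x m) [set b]).
by move=> x y; exact.
Qed.

Lemma mean_split (f : infword -> R) m : bdd_mfun f ->
  mean mu f = \sum_b mean mu (fun x => \1_(letter_at m b) x * f x).
Proof.
move=> bf; rewrite -mean_sum => [|b]; last first.
  by apply: bdd_mfunM => //; apply: bdd_mfun_indic; exact: letter_at_measurable.
congr mean; apply/funext => x; rewrite (bigD1 (x m))//= indicE mem_set// mul1r.
rewrite big1 ?addr0// => b bx; rewrite indicE memNset ?mul0r//.
by move=> xb; rewrite -xb eqxx in bx.
Qed.

Lemma pr_split A m : measurable A -> pr A = \sum_b pr (letter_at m b `&` A).
Proof.
move=> mA; rewrite -[LHS]mean_indic// (mean_split m); last exact: bdd_mfun_indic.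
apply: eq_bigr => b _; transitivity (mean mu \1_(letter_at m b `&` A)).
  by congr mean; rewrite indicI.
by apply: mean_indic; apply: measurableI => //; exact: letter_at_measurable.
Qed.

(** The words overlap in one letter: [v 0] is meant to equal [u n]. In [nb_weight_splice] the factor
    [card] corrects for counting the probability of that letter twice. *)
Definition splice (n : nat) (u v : nat -> letter X) : nat -> letter X :=
  fun i => if (i <= n)%N then u i else v (i - n)%N.

Let card_neq0 : card != 0.
Proof. by rewrite card_q gt_eqF// ltr_wpDr. Qed.

Lemma splice_le n u v i : (i <= n)%N -> splice n u v i = u i.
Proof. by rewrite /splice => ->. Qed.

Lemma splice_add n u v i : v 0%N = u n -> splice n u v (n + i) = v i.
Proof.
move=> vu; rewrite /splice; case: i => [|i]; first by rewrite addn0 leqnn vu.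
by rewrite ifF ?addKn//; apply/negbTE; lia.
Qed.

Lemma nb_weight_splice n k u v : v 0%N = u n ->
  nb_weight (n + k) (splice n u v) = card * nb_weight n u * nb_weight k v.
Proof.
move=> vu; rewrite /nb_weight big_split_ord (mulVKf card_neq0) [RHS]mulrCA.
congr (_ * (_ * _)); apply: eq_bigr => i _ /=.
  by rewrite !splice_le// ltnW.
by rewrite -addnS !splice_add.
Qed.

Definition cons_word (a : letter X) (u : nat -> letter X) : nat -> letter X :=
  fun i => if i is j.+1 then u j else a.

Lemma cylinderS n u : @cylinder X a0 n.+1 u = letter_at 0 (u 0%N) `&` infshift @^-1` cylinder n (u \o S).
Proof.
apply/seteqP; split=> [x xu|x [x0 xu] [|i] //]; last exact: xu.
by split=> [|i ni]; apply: xu.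
Qed.

Lemma nb_weight_cons n a u :
  nb_weight n.+1 (cons_word a u) = nb_step a (u 0%N) * nb_weight n u.
Proof. by rewrite /nb_weight big_ord_recl /= mulrCA. Qed.

(** On cylinders this is stationarity of the uniform law: sum over the letter that the shift
    forgets. *)
Lemma mu_shift A : measurable A -> mu (infshift @^-1` A) = mu A.
Proof.
have ms := @measurable_shift X a0.
pose m0 : {measure set infword -> \bar R} := pushforward mu infshift.
pose m1 := m0 ms.
move=> mA; apply: (@infword_measure_unique X a0 R m1 mu _ _ A mA) => [|[|n] u].
- by rewrite [m1 _]probability_setT ltry.
- by rewrite cylinder0.
have mS : measurable (infshift @^-1` cylinder n.+1 u : set infword).
  by rewrite -[X in measurable X]setTI; apply: (ms measurableT); exact: cylinder_measurable.
transitivity (nb_weight n u)%:E; last exact/esym/mu_cylinder.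
transitivity (pr (infshift @^-1` cylinder n.+1 u))%:E; first exact: prE.
rewrite (pr_split 0 mS); congr _%:E.
rewrite -[RHS]mul1r -(sum_nb_stepl (u 0%N)) mulr_suml; apply: eq_bigr => b _.
by rewrite -nb_weight_cons -pr_cylinder [in RHS]cylinderS.
Qed.

Lemma measurable_iter n : measurable_fun setT (iter n infshift).
Proof. apply: measurable_iter_shift; exact: measurable_shift. Qed.

(** The Markov property at time n; the factor is the probability of the prefix divided by that of
    its last letter. Both sides are finite measures in [A], so cylinders suffice. *)
Lemma pr_markov n u A : measurable A ->
  pr (cylinder n.+1 u `&` iter n infshift @^-1` A) =
  card * nb_weight n u * pr (letter_at 0 (u n) `&` A).
Proof.
have ms := measurable_iter n.
have mc : measurable (cylinder n.+1 u : set infword) by exact: cylinder_measurable.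
have ma := letter_at_measurable 0 (u n).
have w0 : 0 <= card * nb_weight n u by rewrite mulr_ge0 ?nb_weight_ge0.
pose m0 : {measure set infword -> \bar R} :=
  pushforward (mrestr mu mc) (iter n infshift).
pose m1 := m0 ms.
pose m2 : {measure set infword -> \bar R} := mscale (NngNum w0) (mrestr mu ma).
have m1E B : m1 B = mu (iter n infshift @^-1` B `&` cylinder n.+1 u) by [].
have m2E B : m2 B = ((card * nb_weight n u)%:E * mu (B `&` letter_at 0 (u n)))%E by [].
have at0 : pr (letter_at 0 (u n)) = card^-1.
  rewrite (_ : letter_at 0 (u n) = @cylinder X a0 1 (fun=> u n)).
    by rewrite pr_cylinder /nb_weight big_ord0 mulr1.
  by apply/seteqP; split=> [x x0 [|]//|x xu]; exact: xu.
move=> mA; suff : m1 A = m2 A.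
  rewrite m1E m2E !prE => [||]; last 2 first.
  - exact: measurableI.
  - apply: measurableI => //; rewrite -[X in measurable X]setTI; exact: (ms measurableT).
  by move=> [] ; rewrite setIC [A `&` _]setIC.
apply: (@infword_measure_unique X a0 R m1 m2) => // [|[|k] v].
- rewrite m1E; apply: le_lt_trans (ltry 1); apply: probability_le1.
  by apply: measurableI => //; rewrite -[X in measurable X]setTI; exact: (ms measurableT).
- rewrite cylinder0 m1E m2E preimage_setT !setTI mu_cylinder (prE ma) at0 -EFinM.
  by rewrite mulrAC mulfV// mul1r.
rewrite m1E m2E.
(* When the letters agree the two cylinders splice into one; otherwise both sides are measures of
   the empty set. *)
have [vu|vu] := eqVneq (v 0%N) (u n).
  rewrite (_ : _ @^-1` _ `&` _ = @cylinder X a0 (n + k).+1 (splice n u v)).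
    rewrite (_ : cylinder k.+1 v `&` _ = @cylinder X a0 k.+1 v).
      by rewrite !mu_cylinder nb_weight_splice.
    by apply/seteqP; split=> [x []//|x xv]; split=> //; rewrite /letter_at/= xv.
  apply/seteqP; split=> [x [xv xu] i ink|x xs].
    have [ni|/ltnW ni] := leqP i n; first by rewrite splice_le// xu.
    rewrite -{2}(subnKC ni) splice_add// -xv ?iter_shiftE ?subnKC//; lia.
  split=> [j jk|i ni]; last by rewrite xs ?splice_le//; lia.
  by rewrite iter_shiftE xs ?splice_add//; lia.
rewrite (_ : _ @^-1` _ `&` _ = set0).
  rewrite (_ : cylinder k.+1 v `&` _ = set0) ?measure0 ?mule0//.
  by rewrite -subset0 => x [xv xu]; move: vu; rewrite -xv// xu eqxx.
rewrite -subset0 => x [xv xu]; move: vu.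
by rewrite -xv// iter_shiftE addn0 xu ?eqxx.
Qed.

(** The Markov property gives linear equations for the probabilities [h a] of [A] with first letter
    [a]. They force [h] to be constant, so [A] is independent of every cylinder, hence of itself. *)
Lemma shift_ergodic A : measurable A -> infshift @^-1` A = A ->
  mu A = 0%E \/ mu A = 1%E.
Proof.
move=> mA sA.
have iterA n : iter n infshift @^-1` A = A.
  by elim: n => [|n IH] //; rewrite -[in RHS]sA -[in RHS]IH; apply/seteqP; split=> x /=;
    rewrite iterSl.
pose h a := pr (letter_at 0 a `&` A).
have hS : \sum_a h a = pr A by rewrite -pr_split.
(* Split by the second letter b: as [A] is invariant, the Markov property gives that part
   probability [nb_step a b * h b]. *)
have h_eq a : h a = q^-1 * (pr A - h (letter_inv a)).
  rewrite -hS -sum_nb_step {1}/h (pr_split 1); last first.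
    by apply: measurableI => //; exact: letter_at_measurable.
  apply: eq_bigr => b _.
  have := pr_markov 1 (cons_word a (fun=> b)) mA; rewrite iterA.
  rewrite (nb_weight_cons 0 a (fun=> b)) /nb_weight big_ord0 mulr1 mulrCA mulfV// mulr1.
  move=> <-; congr pr; rewrite setIA; congr (_ `&` _).
  apply/seteqP; split=> [x [x1 x0] [|[|]]//|x xab].
  by split; [exact: (xab 1%N) | exact: (xab 0%N)].
have h_const a : h a = card^-1 * pr A.
  have h_mul b : q * h b = pr A - h (letter_inv b).
    by rewrite {1}h_eq mulVKf// gt_eqF.
  have e1 := h_mul a; have := h_mul (letter_inv a); rewrite letter_invK => e2.
  (* Two generators enter here: with a single one q would be 1, and the equation for h(a) - h(a^-1)
     would be void. *)
  have q3 : 3 <= q by rewrite /q ler_nat; lia.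
  have e : h a = h (letter_inv a).
    apply/eqP; rewrite -subr_eq0; have : (q - 1) * (h a - h (letter_inv a)) = 0 by lra.
    by move/eqP; rewrite mulf_eq0 => /orP[|//] /eqP; lra.
  by apply: (canRL (mulKf card_neq0)); rewrite card_q; move: e1; rewrite -e; lra.
pose p := pr A; have p0 : 0 <= p by rewrite fine_ge0.
pose m1 : {measure set infword -> \bar R} := mrestr mu mA.
pose m2 : {measure set infword -> \bar R} := mscale (NngNum p0) mu.
have m1E B : m1 B = mu (B `&` A) by [].
have m2E B : m2 B = (p%:E * mu B)%E by [].
have : m1 A = m2 A.
  apply: (@infword_measure_unique X a0 R m1 m2) => // [|[|n] u].
  - by rewrite m1E setTI prE// ltry.
  - rewrite m1E m2E cylinder0 setTI prE//; transitivity (p%:E * 1%E)%E.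
      by rewrite mule1.
    by congr (_ * _)%E; exact/esym/probability_setT.
  rewrite m1E m2E mu_cylinder prE; last first.
    by apply: measurableI => //; exact: cylinder_measurable.
  congr _%:E; have := pr_markov n u mA; rewrite iterA => ->.
  by rewrite -/(h (u n)) h_const mulrACA mulfV// mul1r mulrC.
rewrite m1E m2E setIid prE// -/p -EFinM => -[pp].
have /eqP : p * (p - 1) = 0 by lra.
by rewrite mulf_eq0 subr_eq0 => /orP[|] /eqP ->; [left|right].
Qed.

End PathMeasure.

(** * Growth of the walk *)

Section WalkMean.
Variables (R : realType) (hT : groupType) (T : {fset hT}) (a0 : letter T).
Hypothesis T_gt1 : (1 < #|{: T}|)%N.
Variable mu : probability (infword a0) R.
Hypothesis mu_cylinder :
  forall n u, mu (@cylinder T a0 n.+1 u) = (@nb_weight R T n u)%:E.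

Definition subword (k n : nat) (x : infword a0) : hT :=
  (\prod_(i < n) letter_val (x (k + i)%N))%g.

Lemma subword_prefix k n (Z : Type) (F : hT -> Z) :
  prefix_fun (k + n) (fun x => F (subword k n x)).
Proof.
move=> x y xy; congr F; apply: eq_bigr => i _.
by rewrite xy// ltn_add2l.
Qed.

Lemma subwordS k n x : subword k n.+1 x = (letter_val (x k) * subword k.+1 n x)%g.
Proof.
rewrite /subword big_ord_recl addn0; congr (_ * _)%g.
by apply: eq_bigr => i _; rewrite addSnnS.
Qed.

Lemma subwordSr k n x :
  subword k n.+1 x = (subword k n x * letter_val (x (k + n)%N))%g.
Proof. exact: big_ord_recr. Qed.

Lemma subwordD m n x : subword 0 (m + n) x = (subword 0 m x * subword m n x)%g.
Proof. exact: big_split_ord. Qed.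

Lemma subword_shift k n x :
  subword 0 n (iter k (@infshift T a0) x) = subword k n x.
Proof. by apply: eq_bigr => i _; rewrite iter_shiftE. Qed.

(** Splitting by letter k+1 extends the prefix and multiplies its weight by [nb_step], which is the
    recursion that defines [nb_cont]. *)
Lemma mean_nb_cont n k u (F : hT -> R) :
  mean mu (fun x => \1_(@cylinder T a0 k.+1 u) x * F (subword k.+1 n x)) =
  nb_weight R k u * nb_cont n (u k) F.
Proof.
have bF m l (F' : hT -> R) : bdd_mfun (fun x : infword a0 => F' (subword m l x)).
  exact: prefix_bdd_mfun (subword_prefix F').
have bI m v : bdd_mfun (\1_(@cylinder T a0 m v) : infword a0 -> R).
  by apply: bdd_mfun_indic; exact: cylinder_measurable.
elim: n k u F => [|n IH] k u F.
  under eq_fun do rewrite /subword big_ord0 mulrC.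
  rewrite meanZ// mean_indic; last exact: cylinder_measurable.
  by rewrite mu_cylinder /= mulrC.
rewrite (mean_split mu k.+1); last exact: bdd_mfunM.
pose v b i := if (i <= k)%N then u i else b.
have vE b : nb_weight R k.+1 (v b) = nb_weight R k u * nb_step R (u k) b.
  rewrite /nb_weight big_ord_recr /= -mulrA; congr (_ * _); rewrite /v leqnn ltnn.
  by congr (_ * _); apply: eq_bigr => i _; rewrite ltn_ord ltnW// ltn_ord.
transitivity (\sum_b nb_weight R k u * (nb_step R (u k) b
    * nb_cont n b (fun g => F (letter_val b * g)%g))).
  apply: eq_bigr => b _; rewrite mulrA -vE.
  have vb : v b k.+1 = b by rewrite /v ltnn.
  have vu i : (i < k.+1)%N -> v b i = u i by rewrite /v ltnS => ->.
  rewrite -[X in nb_cont n X]vb -IH; congr mean; apply/funext => x.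
  rewrite !indicE.
  have -> : (x \in @cylinder T a0 k.+2 (v b)) =
      (x \in @letter_at T a0 k.+1 b) && (x \in @cylinder T a0 k.+1 u).
    apply/idP/andP => [/set_mem xv|[/set_mem xb /set_mem xu]].
      split; apply/mem_set; first by rewrite /letter_at /= -[RHS]vb; exact: xv.
      by move=> i ik; rewrite -vu//; apply: xv; exact: ltnW.
    apply/mem_set => i; rewrite ltnS leq_eqVlt => /orP[/eqP ->|ik].
      by rewrite vb.
    by rewrite vu//; exact: xu.
  have [/set_mem xb|] := boolP (x \in @letter_at T a0 _ _); last by rewrite !mul0r.
  by rewrite mul1r subwordS xb.
rewrite -mulr_sumr sum_nb_step /=; congr (_ * (_ * _)).
by rewrite (bigD1 (letter_inv (u k)))//= addrC addrK.
Qed.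

Lemma mean_subword n (F : hT -> R) :
  mean mu (fun x => F (subword 0 n x)) = nb_mean T n F.
Proof.
case: n => [|n].
  by under eq_fun do rewrite /subword big_ord0; rewrite mean_cst.
rewrite (mean_split mu 0); last exact: prefix_bdd_mfun (subword_prefix F).
rewrite /nb_mean mulr_sumr; apply: eq_bigr => b _.
transitivity (nb_weight R 0 (fun=> b) * nb_cont n b (fun g => F (letter_val b * g)%g)).
  rewrite -[RHS](mean_nb_cont n 0 (fun=> b)); congr mean; apply/funext => x.
  rewrite !indicE; have -> : (x \in @cylinder T a0 1 (fun=> b)) = (x \in @letter_at T a0 0 b).
    by apply/idP/idP => /set_mem xb; apply/mem_set; [exact: xb|case].
  have [/set_mem xb|] := boolP (x \in @letter_at T a0 _ _); last by rewrite !mul0r.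
  by rewrite subwordS xb.
by rewrite /nb_weight big_ord0 mulr1 card_letter.
Qed.

End WalkMean.

(** * The growth exponent and convergence along the walk *)

Section LogGrowth.
Variables (R : realType) (G : groupType) (S : {fset G}) (T : {fset aut G}).
Hypotheses (G_nontrivial : exists g : G, g <> 1%g) (S_gen : generating_set S).
Hypothesis T_gt1 : (1 < #|{: T}|)%N.
Local Notation log_norm := (@log_norm R G S).

Let T_gt0 : (0 < #|{: T}|)%N := ltnW T_gt1.

Definition mean_growth (n : nat) : R := nb_mean T n log_norm.

Definition growth_bounds : set R :=
  [set x | exists N, forall n, (N <= n)%N -> mean_growth n <= x * n%:R].

(** The infimum of the eventual linear bounds is the limsup of [mean_growth n / n]. *)
Definition growth_exponent : R := inf growth_bounds.

Lemma mean_growth_ge0 n : 0 <= mean_growth n.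
Proof. by apply: nb_mean_ge0 => // g; exact: log_norm_ge0. Qed.

Lemma growth_bounds_ge0 : lbound growth_bounds 0.
Proof.
move=> x [N /(_ N.+1 (leqnSn N))] xN.
have : 0 <= x * N.+1%:R by apply: le_trans xN; exact: mean_growth_ge0.
by rewrite pmulr_lge0.
Qed.

Lemma growth_bounds_has_inf : has_inf growth_bounds.
Proof.
split; last by exists 0; exact: growth_bounds_ge0.
have [C _ CP] := @log_norm_letter_le R _ _ G_nontrivial S_gen T.
exists C, 0%N => n _; apply: nb_mean_le_linear => //; first exact: log_norm1.
by move=> a g; apply: le_trans (log_normM _ G_nontrivial S_gen _ _) _; rewrite lerD2r.
Qed.

Lemma growth_exponent_ge0 : 0 <= growth_exponent.
Proof. by apply: lb_le_inf; [case: growth_bounds_has_inf | exact: growth_bounds_ge0]. Qed.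

Lemma mean_growth_le (e : R) : 0 < e -> exists N, forall n, (N <= n)%N ->
  mean_growth n <= (growth_exponent + e) * n%:R.
Proof.
move=> e0; have [x [N xN] xe] := inf_adherent e0 growth_bounds_has_inf.
exists N => n /xN h; apply: le_trans h _.
by rewrite ler_wpM2r// ltW.
Qed.

Lemma mean_growth_ge (e : R) N : 0 < e -> exists2 n, (N <= n)%N &
  (growth_exponent - e) * n%:R <= mean_growth n.
Proof.
move=> e0; apply: contrapT => H.
suff : growth_exponent <= growth_exponent - e by rewrite lerBrDr gerDl leNgt e0.
apply: ge_inf; first by exists 0; exact: growth_bounds_ge0.
exists N => n Nn; rewrite leNgt; apply/negP => h; apply: H; exists n => //.
exact: ltW.
Qed.

Section Words.
Variable a0 : letter T.
Variable mu : probability (infword a0) R.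
Hypothesis mu_cylinder :
  forall n u, mu (@cylinder T a0 n.+1 u) = (@nb_weight R T n u)%:E.

Definition word_growth (n : nat) (x : infword a0) : R := log_norm (subword 0 n x).

(** Shifting the word multiplies its product by one letter on each side, so the log norm moves by at
    most twice the bound for a letter. *)
Lemma word_growth_letter : exists2 C, 0 <= C & forall n x,
  [/\ 0 <= word_growth n x, word_growth n x <= C * n%:R &
      `|word_growth n (infshift x) - word_growth n x| <= C].
Proof.
have [C C0 CP] := @log_norm_letter_le R _ _ G_nontrivial S_gen T.
have logM g h := @log_normM R _ _ G_nontrivial S_gen g h.
exists (C + C) => [|n x]; first by rewrite addr_ge0// ltW.
split; first exact: log_norm_ge0.
  elim: n => [|n IH]; first by rewrite mulr0 /word_growth /subword big_ord0; exact: log_norm1.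
  rewrite /word_growth subwordSr; apply: le_trans (logM _ _) _.
  rewrite -natr1 mulrDr mulr1 lerD//; apply: le_trans (CP _) _.
  by rewrite lerDl ltW.
have shiftE : subword 0 n (infshift x) =
    (letter_val (letter_inv (x 0%N)) * subword 0 n x * letter_val (x n))%g.
  rewrite letter_valV -mulgA -[x n]/(x (0 + n)%N) -subwordSr subwordS mulKg.
  exact: (subword_shift 1).
have shiftE' : subword 0 n x =
    (letter_val (x 0%N) * subword 0 n (infshift x) * letter_val (letter_inv (x n)))%g.
  by rewrite shiftE !letter_valV !mulgA mulgV mul1g mulgK.
rewrite /word_growth ler_distl; apply/andP; split.
  rewrite lerBlDr {1}shiftE'; apply: le_trans (logM _ _) _.
  have := logM (letter_val (x 0%N)) (subword 0 n (infshift x)).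
  have := CP (x 0%N); have := CP (letter_inv (x n)); lra.
rewrite {1}shiftE; apply: le_trans (logM _ _) _.
have := logM (letter_val (letter_inv (x 0%N))) (subword 0 n x).
have := CP (letter_inv (x 0%N)); have := CP (x n); lra.
Qed.

Lemma word_growth_cvg : {ae mu, forall x,
  word_growth n x / n%:R @[n --> \oo] --> growth_exponent}.
Proof.
have [C C0 CP] := word_growth_letter.
have mean_word n : mean mu (word_growth n) = mean_growth n.
  exact: (mean_subword mu_cylinder n log_norm).
apply: (@subadditive_cvg _ _ _ mu (@infshift T a0) _ _ _ word_growth C).
- exact: measurable_shift.
- exact: mu_shift mu_cylinder.
- exact: shift_ergodic mu_cylinder.
- move=> n; exact: (prefix_bdd_mfun (@subword_prefix _ T a0 0 n _ log_norm)).1.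
- by move=> n x; have [] := CP n x.
- by move=> n x; have [] := CP n x.
- move=> m n x; rewrite /word_growth subwordD -(subword_shift m).
  exact: log_normM.
- by move=> n x; have [] := CP n x.
- by move=> e e0; have [N NP] := mean_growth_le e0; exists N => n; rewrite mean_word; exact: NP.
- by move=> e N e0; have [n Nn nP] := mean_growth_ge N e0; exists n => //; rewrite mean_word.
Qed.

End Words.

(** * Transfer from infinite words to an arbitrary probability space *)

Section Walk.
Context {d : measure_display} {Omega : measurableType d}.
Variables (P : probability Omega R) (t : nat -> Omega -> letter T).
Hypothesis t_nb : nonbacktracking_word P t.
Variable a0 : letter T.

Definition trajectory (w : Omega) : infword a0 := fun n => t n w.

Lemma trajectory_measurable : measurable_fun setT trajectory.
Proof.
have [mt _ _] := t_nb.
have H := @measurability _ _ Omega (infword a0) setT trajectory (@cylinders T a0) erefl.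
apply: H => _ [B [->|[n [u ->]]] <-]; first by rewrite preimage_set0 setI0.
rewrite setTI (_ : _ @^-1` _ = \bigcap_(i in [set i | (i < n)%N]) (t i @^-1` [set u i])).
  by apply: bigcap_measurableType => i _; exact: mt.
by apply/seteqP; split.
Qed.

HB.instance Definition _ :=
  isMeasurableFun.Build _ _ _ _ trajectory trajectory_measurable.

(** The conditions on [t] fix the cylinder probabilities of this law, so the almost sure statement
    on words pulls back along [trajectory]. *)
Definition word_law : probability (infword a0) R := distribution P trajectory.

Lemma word_law_cylinder n u : word_law (@cylinder T a0 n.+1 u) = (@nb_weight R T n u)%:E.
Proof.
have [_ t0 tS] := t_nb.
have lawE m : word_law (@cylinder T a0 m.+1 u) =
  P [set w | forall i, (i <= m)%N -> t i w = u i] by [].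
elim: n => [|n IH].
  rewrite lawE (_ : [set w | _] = t 0%N @^-1` [set u 0%N]).
    by rewrite t0 /nb_weight big_ord0 mulr1.
  by apply/seteqP; split=> [w /(_ 0%N)|w tw [|i]]//; exact.
rewrite lawE tS -lawE IH -EFinM /nb_weight big_ord_recr /= mulrA.
by rewrite /nb_step.
Qed.

Lemma word_growth_trajectory n w :
  log_growth_rate S (walk t) n w = word_growth n (trajectory w) / n%:R.
Proof. by []. Qed.

Lemma walk_cvg_as : cvg_as P (log_growth_rate S (walk t)) growth_exponent.
Proof.
have [N [mN N0 sN]] := word_growth_cvg word_law_cylinder.
exists (trajectory @^-1` N); split => //.
  by rewrite -[X in measurable X]setTI; exact: trajectory_measurable.
by move=> w /= Hw; exact: sN.
Qed.

(** The rates are bounded by a constant, so almost sure convergence gives L1 convergence by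
    dominated convergence. *)
Lemma walk_cvg_L1 : cvg_L1 P (log_growth_rate S (walk t)) growth_exponent.
Proof.
have [C C0 CP] := word_growth_letter a0.
pose f n w := log_growth_rate S (walk t) n w : R.
have mf n : measurable_fun setT (f n).
  apply: (measurableT_comp (f := fun x => word_growth n x / n%:R) _ trajectory_measurable).
  exact: (prefix_bdd_mfun (@subword_prefix _ T a0 0 n _ (fun g => log_norm g / n%:R))).1.
have f_le n w : `|f n w| <= C.
  rewrite /f word_growth_trajectory; have [h0 h1 _] := CP n (trajectory w).
  (* At n = 0 the quotient is 0, because the inverse of 0 is 0. *)
  rewrite ger0_norm ?divr_ge0//; case: n h0 h1 => [|n] h0 h1; first by rewrite invr0 mulr0.
  by rewrite ler_pdivrMr.
have fint n : P.-integrable setT (EFin \o f n).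
  by apply: bdd_mfun_integrable; split => //; exists C.
split; first by move=> n; apply/Lfun1_integrable; exact: fint.
have [] := @dominated_convergence _ _ _ P setT measurableT
  (fun n w => (f n w)%:E) (cst growth_exponent%:E) (cst C%:E).
- by move=> n; apply/measurable_EFinP; exact: mf.
- exact: measurable_cst.
- have := walk_cvg_as; apply: filterS => w fw _.
  by apply: cvg_EFin => //; exact: nearW.
- exact: finite_measure_integrable_cst.
- by apply: aeW => w n _; rewrite /= lee_fin.
move=> _ + _; apply: cvg_trans; apply: near_eq_cvg; apply: nearW => n.
by rewrite Lnorm1; apply: eq_integral => w _; rewrite EFinB.
Qed.

End Walk.

Lemma growth_exponent_gt0 : polynomial_growth G ->
  ~ amenable R (generated [set` T]) -> 0 < growth_exponent.
Proof.
move=> polyG; apply: contra_notT; rewrite -leNgt => nu_le0.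
apply: (amenable_of_slow_norm G_nontrivial S_gen T_gt0 polyG) => e e0.
have [N NP] := mean_growth_le e0; exists N => n /NP h; apply: le_trans h _.
by rewrite ler_wpM2r// gerDr.
Qed.

End LogGrowth.

Lemma noncyclic_card (gT : groupType) (T : {fset gT}) :
  ~ cyclic_subgroup (generated [set` T]) -> (1 < #|{: T}|)%N.
Proof.
apply: contra_notT; rewrite -leqNgt -cardfE leq_eqVlt ltnS leqn0 => /orP[|].
  by move=> /cardfs1P[h ->]; exists h; rewrite set_fset1.
(* The empty set generates the trivial group, which is cyclic with generator 1. *)
rewrite cardfs_eq0 => /eqP ->; exists 1%g; rewrite set_fset0.
apply/seteqP; split; apply: generated_sub => //; try exact: generated_group.
by move=> _ ->; apply: subgroup1; exact: generated_group.
Qed.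

Theorem theorem2 (R : realType) (G : groupType) (S : {fset G})
    (H : set (aut G)) (T : {fset aut G})
    (G_nontrivial : exists g : G, g <> 1%g)
    (S_gen : generating_set S)
    (H_subgroup : subgroup H)
    (H_noncyclic : ~ cyclic_subgroup H)
    (T_gen : generated [set` T] = H) :
  exists nu : R,
    [/\ 0 <= nu,
        forall (d : measure_display) (Omega : measurableType d)
          (P : probability Omega R) (t : nat -> Omega -> letter T),
          nonbacktracking_word P t ->
          cvg_as P (log_growth_rate S (walk t)) nu /\
          cvg_L1 P (log_growth_rate S (walk t)) nu
      & polynomial_growth G -> ~ amenable R H -> 0 < nu].
Proof.
move: H_noncyclic; rewrite -T_gen => /noncyclic_card T_gt1.
have /card_gt0P[x _] := ltnW T_gt1.
(* The exponent is defined through [nb_mean], with no reference to a probability space, so one value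
   serves every [P] and [t]. *)
exists (growth_exponent R S T); split; first exact: growth_exponent_ge0.
- move=> d Omega P t t_nb.
  by split; [exact: (walk_cvg_as _ _ _ t_nb (x, true)) |
             exact: (walk_cvg_L1 _ _ _ t_nb (x, true))].
- exact: growth_exponent_gt0.
Qed.
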